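(* Let $G$ be a discrete abelian group, $S=G\setminus\{0\}$, $p\in(1,\infty)$, and let $\mu_0,\mu_n\in\mathcal M$ $(n\in\mathbb N)$ be absolutely continuous with respect to $\lambda$. If $\mathrm{m}\text{-}\lim\mu_n=\mu_0$ and $\mu_n\ge c\mu_0$ for all $n\in\mathbb N$ and some positive number $c$, then $\lim_{n\to\infty}d_p(\mu_n;S)=d_p(\mu_0;S)$. If, additionally, $\mu_0\ll\mu_n$ for all $n\in\mathbb N$, then also $\lim_{n\to\infty}\int|\phi_{\mu_0,p}(S)-\phi_{\mu_n,p}(S)|^p\,d\mu_0=0$.
   Context: $G$ is a discrete abelian group (written additively, $G\ne\{0\}$), $\Gamma$ is its compact dual group with normalized Haar measure $\lambda$, and for $x\in G$, $e_x:\Gamma\to\mathbb C$ is the character of $\Gamma$ generated by $x$. $\mathcal M$ is the set of all non-zero finite non-negative regular Borel measures on $\Gamma$; inequalities between measures are setwise. For $S\subseteq G\setminus\{0\}$ non-empty, $\mathcal T(S)$ is the complex linear space of all finite sums $\sum_j a_je_{x_j}$, $a_j\in\mathbb C$, $x_j\in S$; $d_p(\mu;S):=\inf\{\int|1-\tau|^p\,d\mu:\tau\in\mathcal T(S)\}$; $[\mathcal T(S)]_{\mu,p}$ is the closure of $\mathcal T(S)$ in $L^p(\mu)$. For $p\in(1,\infty)$, the metric projection $\phi_{\mu,p}(S)$ is the unique element of $[\mathcal T(S)]_{\mu,p}$ with $\int|1-\phi_{\mu,p}(S)|^p\,d\mu=d_p(\mu;S)$. $\mathrm{m}\text{-}\lim\mu_n=\mu_0$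 (convergence in measure) means: for some (equivalently, every) $\nu\in\mathcal M$ with $\mu_k\ll\nu$ for all $k\in\mathbb N_0$, the Radon-Nikodym derivatives $\frac{d\mu_n}{d\nu}$ converge to $\frac{d\mu_0}{d\nu}$ in measure $\nu$. *)

(* Defs.v *)
From HB Require Import structures.
From mathcomp Require Import all_boot all_order all_algebra complex.
From mathcomp Require Import all_classical all_reals all_analysis.

Set Implicit Arguments.
Unset Strict Implicit.
Unset Printing Implicit Defensive.

Import Order.TTheory GRing.Theory Num.Theory.
Import numFieldNormedType.Exports.

Local Open Scope classical_set_scope.
Local Open Scope ring_scope.

(* As the abelian group [G] is discrete, the
   compact-open topology of its dual is that of pointwise convergence. *)
Record dual (R : realType) (G : zmodType) := Dual {
  dual_fun :> G -> R[i];
  dual_norm1 : forall x, `|dual_fun x| = 1;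
  dualD : forall x y, dual_fun (x + y) = dual_fun x * dual_fun y }.

Section dual_group.
Context {R : realType} {G : zmodType}.

Lemma dual_one_norm1 (x : G) : `|1 : R[i]| = 1.
Proof. exact: normr1. Qed.

Lemma dual_oneD (x y : G) : 1 = 1 * 1 :> R[i].
Proof. by rewrite mulr1. Qed.

Definition dual_one : dual R G := Dual dual_one_norm1 dual_oneD.

Lemma dual_mul_norm1 (g h : dual R G) x : `|g x * h x| = 1.
Proof. by rewrite normrM !dual_norm1 mulr1. Qed.

Lemma dual_mulD (g h : dual R G) x y :
  g (x + y) * h (x + y) = (g x * h x) * (g y * h y).
Proof. by rewrite !dualD mulrACA. Qed.

Definition dual_mul (g h : dual R G) : dual R G :=
  Dual (dual_mul_norm1 g h) (dual_mulD g h).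

HB.instance Definition _ := gen_eqMixin (dual R G).
HB.instance Definition _ := gen_choiceMixin (dual R G).
HB.instance Definition _ := isPointed.Build (dual R G) dual_one.
HB.instance Definition _ := Topological.copy (dual R G)
  (initial_topology
     (@dual_fun R G : dual R G -> {ptws G -> (R[i] : numFieldType)})).
HB.instance Definition _ := Measurable.copy (dual R G)
  (g_sigma_algebraType (@open (dual R G))).

End dual_group.

Section measures.
Context {R : realType} {G : zmodType}.
Local Notation Gamma := (dual R G).
Implicit Types mu nu lambda : {finite_measure set Gamma -> \bar R}.

Definition regular_measure mu := forall A : set Gamma, measurable A ->
  mu A = ereal_sup [set mu K | K in [set K | compact K /\ K `<=` A]] /\
  mu A = ereal_inf [set mu U | U in [set U | open U /\ A `<=` U]].

Definition classM mu := regular_measure mu /\ mu [set: Gamma] != 0%E.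

Definition normalized_haar lambda :=
  [/\ regular_measure lambda, lambda [set: Gamma] = 1%E
    & forall (g : Gamma) (A : set Gamma), measurable A ->
        lambda (dual_mul g @` A) = lambda A].

Definition RN_derivative mu nu : Gamma -> \bar R :=
  Radon_Nikodym (charge_of_finite_measure mu) nu.

Definition cvg_in_measure nu (f : nat -> Gamma -> \bar R) (f0 : Gamma -> \bar R) :=
  forall e : R, 0 < e ->
    nu [set x | (e%:E <= `|f n x - f0 x|)%E] @[n --> \oo] --> 0%E.

Definition mlim (mu : nat -> {finite_measure set Gamma -> \bar R}) mu0 :=
  exists nu : {finite_measure set Gamma -> \bar R},
    [/\ classM nu, mu0 `<< nu, (forall n, mu n `<< nu)
      & cvg_in_measure nu (fun n => RN_derivative (mu n) nu)
                          (RN_derivative mu0 nu)].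

End measures.

Section metric_projection.
Context {R : realType} {G : zmodType}.
Local Notation Gamma := (dual R G).
Implicit Types (mu : {finite_measure set Gamma -> \bar R}) (p : R) (S : set G).
Implicit Types f tau phi : Gamma -> R[i].

Definition echar (x : G) : Gamma -> R[i] := fun g => g x.

Definition trig_poly S : set (Gamma -> R[i]) :=
  [set tau | exists (n : nat) (a : 'I_n -> R[i]) (x : 'I_n -> G),
     (forall j, S (x j)) /\ tau = fun g => \sum_(j < n) a j * echar (x j) g].

Definition int_pow mu p f : \bar R :=
  (\int[mu]_g ((Normc.normc (f g)) `^ p)%:E)%E.

Definition dist_p mu p S : \bar R :=
  ereal_inf [set int_pow mu p (fun g => 1 - tau g) | tau in trig_poly S].

(* The library's L^p spaces are real-valued; complex functions stand here for
   their classes modulo [mu]-a.e. equality. *)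
Definition cmeasurable f :=
  measurable_fun [set: Gamma] (fun g => complex.Re (f g)) /\
  measurable_fun [set: Gamma] (fun g => complex.Im (f g)).

Definition cLp mu p f := cmeasurable f /\ (int_pow mu p f < +oo)%E.

Definition cLp_norm mu p f : \bar R :=
  Lnorm mu p%:E (fun g => (Normc.normc (f g))%:E).

Definition cLp_closure mu p (E : set (Gamma -> R[i])) : set (Gamma -> R[i]) :=
  [set f | cLp mu p f /\ forall e : R, 0 < e ->
     exists2 tau, E tau & (cLp_norm mu p (fun g => (f g - tau g)%R) < e%:E)%E].

(* [phi] represents the metric projection of 1 onto the closure of the
   trigonometric polynomials; for 1 < p it is unique [mu]-a.e. *)
Definition is_metric_projection mu p S phi :=
  cLp_closure mu p (trig_poly S) phi /\
  int_pow mu p (fun g => 1 - phi g) = dist_p mu p S.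

End metric_projection.

(* Main.v *)
Require Import Defs.
From HB Require Import structures.
From mathcomp Require Import all_boot all_order all_algebra complex finmap.
From mathcomp Require Import all_classical all_reals all_analysis.
From mathcomp Require Import measurable_realfun ring lra.

Set Implicit Arguments.
Unset Strict Implicit.
Unset Printing Implicit Defensive.

Import Order.TTheory GRing.Theory Num.Theory.
Import numFieldNormedType.Exports.

Local Open Scope classical_set_scope.
Local Open Scope ring_scope.

(** The proof rests on Kolmogorov's formula for the distance: with S the set of
    all non-zero elements of G and d mu = w d lambda, p > 1,

      d_p(mu; S) = W ^ (1 - p),   W = the lambda-integral of w ^ (- 1 / (p - 1)),

    where w ^ (- 1 / (p - 1)) = +oo at the zeros of w and W ^ (1 - p) = 0 for
    W = +oo ([dist_pE]). Put v = w ^ (- 1 / (p - 1)).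

    Lower bound. A competitor f = 1 - tau has lambda-mean 1, as the non-trivial
    characters have mean zero by invariance of lambda. The tangent to t ^ p at
    v / W, multiplied by w, gives

      |f| ^ p w + (p - 1) W ^ (- p) v >= p W ^ (1 - p) Re f,

    and integration gives the bound. When W is finite, this also shows that
    convergence in L^p(mu) implies convergence in L^1(lambda), so that the mean
    is still 1 on the closure of the competitors; and the equality case
    of the tangent inequality identifies the metric projection phi by
    1 - phi = v / W almost everywhere ([metric_projectionE]).

    Upper bound. A bounded function f of lambda-mean 1 is admissible, because
    1 - f is a limit in L^p(mu) of trigonometric polynomials without constant
    coefficient ([mean_zero_dense]). The normalizations of the functions
    (w + 1 / (k + 1)) ^ (- 1 / (p - 1)) are then competitors whose integrals tend to
    W ^ (1 - p). The density of trigonometric polynomials is proved without any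
    uniform approximation theorem: the bounded limits in L^p of an algebra of
    bounded functions are stable under bounded pointwise limits,
    hence the measurable sets whose indicator is such a limit form a sigma-algebra;
    this one contains the sublevel sets of the real trigonometric polynomials, and all
    open sets by inner regularity of the measures ([real_trig_poly_dense]).

    Convergence. Convergence in measure yields, along subsequences, densities w n
    that converge lambda-almost everywhere to w0, and the assumption on the measures
    becomes w n >= c w0. If W0 is finite, the functions v n are dominated by a
    multiple of v0; if W0 = +oo, the integrals W n tend to +oo as in Fatou's lemma.
    Hence W n tends to W0 and the distances converge. In the first case the explicit
    projections converge almost everywhere with the same domination; in the second one,
    both 1 - phi0 and 1 - phi n tend to 0 in L^p(mu0), as the integrals of their powers
    are at most 1 / c times distances tending to 0.

    The formula uses that every x != 0 is moved away from 1 by some g in the dual. If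
    some x != 0 were not, its character would be the constant 1 and all
    distances would vanish, in which case the conclusion is immediate. *)

(** * Inequalities and limits for real powers *)

Section powR_inequalities.
Context {R : realType}.
Implicit Types p s t a b : R.

(** With y = ln t, and after division by t, this is the sum of the inequalities
    [1 + z <= expR z] at z = (p - 1) y and, with weight p - 1, at z = - y. *)
Lemma powR_tangent1_lt p t : 1 < p -> 0 <= t -> t != 1 ->
  p * t < t `^ p + (p - 1).
Proof.
move=> p1 t0 t1; have [->|tn0] := eqVneq t 0.
  by rewrite powR0 ?gt_eqF ?(lt_trans _ p1)// mulr0 add0r subr_gt0.
have {}t0 : 0 < t by rewrite lt_neqAle eq_sym tn0.
have yn0 : ln t != 0 by rewrite ln_eq0.
set y := ln t in yn0.
have ty : t = expR y by rewrite /y lnK.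
have -> : t `^ p = expR y * expR ((p - 1) * y).
  by rewrite ty -expRM -expRD; congr expR; ring.
have h1 : 1 + (p - 1) * y <= expR ((p - 1) * y) by exact: expR_ge1Dx.
have h2 : 1 - y < expR (- y) by apply: expR_gt1Dx; rewrite oppr_eq0.
have h3 : expR y * expR (- y) = 1 by rewrite -expRD subrr expR0.
have e0 : 0 < expR y by exact: expR_gt0.
rewrite ty.
have h4 : p < expR ((p - 1) * y) + (p - 1) * expR (- y) by nra.
have : expR y * p < expR y * (expR ((p - 1) * y) + (p - 1) * expR (- y)).
  by rewrite ltr_pM2l.
by rewrite mulrDr mulrCA h3 mulr1 mulrC.
Qed.

Lemma mulr_powRB1 s p : 0 < s -> s * s `^ (p - 1) = s `^ p.
Proof.
move=> s0; rewrite -{1}(powRr1 (ltW s0)) -powRD ?subrKC//.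
by apply/implyP => _; rewrite gt_eqF.
Qed.

(** The tangent at s to the strictly convex function t `^ p, by homogeneity from s = 1. *)
Lemma powR_tangent_lt p s t : 1 < p -> 0 < s -> 0 <= t -> t != s ->
  p * s `^ (p - 1) * t < t `^ p + (p - 1) * s `^ p.
Proof.
move=> p1 s0 t0 ts.
have u0 : 0 <= t / s by rewrite divr_ge0 // ltW.
have u1 : t / s != 1.
  by apply: contra ts => /eqP h; rewrite -(divfK (lt0r_neq0 s0) t) h mul1r.
have := powR_tangent1_lt p1 u0 u1.
have sp : s `^ p = s * s `^ (p - 1) by rewrite mulr_powRB1.
have tE : t `^ p = s `^ p * (t / s) `^ p.
  by rewrite -powRM// ?ltW// mulrC divfK// gt_eqF.
have sp0 : 0 < s `^ p by exact: powR_gt0.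
rewrite -(ltr_pM2l sp0) mulrDr -tE [s `^ p * (p - 1)]mulrC.
congr (_ < _); rewrite sp; field; exact: lt0r_neq0.
Qed.

(** Convexity of the power at the points a / (1 - d) and b / d. A small d keeps the
    first coefficient close to 1, so that b acts as a perturbation of a. *)
Lemma powRD_le p d a b : 1 <= p -> 0 < d < 1 -> 0 <= a -> 0 <= b ->
  (a + b) `^ p <= (1 - d) `^ (1 - p) * a `^ p + d `^ (1 - p) * b `^ p.
Proof.
move=> p1 /andP[d0 d1] a0 b0.
have d1' : 0 < 1 - d by rewrite subr_gt0.
have dN : d != 0 by rewrite gt_eqF.
have dN' : 1 - d != 0 by rewrite gt_eqF.
have key e x : 0 < e -> 0 <= x -> e `^ (1 - p) * x `^ p = e * (x / e) `^ p.
  move=> e0 x0; rewrite powRM ?invr_ge0 ?(ltW e0)//.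
  rewrite -[e^-1]powR_inv1 ?(ltW e0)// -powRrM mulN1r powRD; last first.
    by apply/implyP => _; rewrite gt_eqF.
  by rewrite powRr1 ?(ltW e0)// mulrAC mulrA.
have := @convex_powR R p p1 (Itv01 (ltW d0) (ltW d1)) (b / d) (a / (1 - d)).
rewrite !inE/= !in_itv/= !andbT !divr_ge0 ?(ltW d0) ?(ltW d1')//.
move=> /(_ isT isT); rewrite convRE [conv _ _ _]convRE /= /unstable.onem.
rewrite [d * _]mulrC divfK// [(1 - d) * (_ / _)]mulrC divfK// !key//.
by rewrite addrC [X in _ <= X]addrC.
Qed.

Lemma cvg_powR0 p (u : nat -> R) : 0 < p -> (forall n, 0 <= u n) ->
  u n @[n --> \oo] --> 0 -> u n `^ p @[n --> \oo] --> 0.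
Proof.
move=> p0 u0 /cvgrPdist_le cu; apply/cvgrPdist_le => e e0.
have d0 : 0 < e `^ p^-1 by exact: powR_gt0.
apply: filterS (cu _ d0) => n; rewrite !sub0r !normrN !ger0_norm ?powR_ge0//.
move=> une; rewrite -[leRHS]powRr1 ?(ltW e0)// -(mulVf (lt0r_neq0 p0)) powRrM.
by rewrite ge0_ler_powR ?nnegrE ?powR_ge0// ltW.
Qed.

Lemma cvg_powR a (l : R) (u : nat -> R) : 0 < l ->
  u n @[n --> \oo] --> l -> u n `^ a @[n --> \oo] --> l `^ a.
Proof.
move=> l0 cu; have lE : l `^ a = expR (a * ln l) by rewrite /powR gt_eqF.
rewrite lE; apply: (@cvg_trans _ ((fun n => expR (a * ln (u n))) @ \oo)).
  apply: near_eq_cvg; near=> n; rewrite /powR gt_eqF//.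
  by near: n; exact: cvgr_gt cu _ l0.
apply: continuous_cvg; first exact: continuous_expR.
by apply: cvgMr; apply: continuous_cvg cu; exact: continuous_ln.
Unshelve. all: by end_near.
Qed.

Lemma cvg_inv1DX (t : R) : 0 <= t ->
  (1 + t ^+ n)^-1 @[n --> \oo] -->
    ((if t < 1 then 1 else if t == 1 then 2^-1 else 0) : R).
Proof.
move=> t0; case: ltP => [t1|t1].
  rewrite -[X in _ --> X]invr1; apply: cvgV; first exact: oner_neq0.
  rewrite -[X in _ --> X]addr0; apply: cvgD; first exact: cvg_cst.
  have := @cvg_geometric R 1 t; rewrite ger0_norm// => /(_ t1).
  by rewrite /geometric /=; under eq_fun do rewrite mul1r.
case: eqVneq => [->|t1'].
  by under eq_fun do rewrite expr1n; exact: cvg_cst.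
have {t1'}t1 : 1 < t by rewrite lt_neqAle eq_sym t1' t1.
have t0' : 0 < t by exact: lt_trans t1.
apply: (@squeeze_cvgr _ _ _ _ (cst 0) (fun n => t^-1 ^+ n)).
- apply: nearW => n; apply/andP; split; first by rewrite invr_ge0 addr_ge0 ?exprn_ge0.
  have tn0 : 0 < t ^+ n by exact: exprn_gt0.
  by rewrite exprVn lef_pV2 ?posrE ?lerDr// ltr_wpDr// ltW.
- exact: cvg_cst.
- have := @cvg_geometric R 1 t^-1; rewrite ger0_norm ?invr_ge0 ?ltW// invf_lt1// => /(_ t1).
  by rewrite /geometric /=; under eq_fun do rewrite mul1r.
Qed.

End powR_inequalities.

(** * Densities and convergence in measure *)

(** Convergence in measure gives almost everywhere convergence along
    subsequences only; the indices g n are not required to increase. *)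
Lemma cvg_subseqs {T : topologicalType} (u : nat -> T) (l : T) :
  (forall f : nat -> nat, f n @[n --> \oo] --> \oo ->
     exists2 g : nat -> nat, g n @[n --> \oo] --> \oo &
       u (f (g n)) @[n --> \oo] --> l) ->
  u n @[n --> \oo] --> l.
Proof.
move=> sub V lV; apply: contrapT => uV.
have /choice[f fP] : forall N, exists n, (N <= n)%N /\ ~ V (u n).
  move=> N; apply: contrapT => /forallNP h; apply: uV.
  exists N => // n /= Nn; apply: contrapT => Vn; exact: (h n).
have foo : f n @[n --> \oo] --> \oo.
  move=> B [M _ MB]; exists M => // n /= Mn; apply: MB => /=.
  exact: leq_trans Mn (fP n).1.
have [g goo /(_ V lV)[N _ NV]] := sub f foo.
exact: (fP (g N)).2 (NV N (leqnn N)).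
Qed.

Section density.
Context d (T : measurableType d) (R : realType).
Implicit Types mu nu la : {finite_measure set T -> \bar R}.
Local Open Scope ereal_scope.

Definition has_density mu la (w : T -> R) :=
  [/\ measurable_fun [set: T] w, forall x, (0 <= w x)%R &
    forall F : T -> \bar R, (forall x, 0 <= F x) -> measurable_fun [set: T] F ->
      \int[mu]_x F x = \int[la]_x (F x * (w x)%:E)].

(** Unlike the Radon-Nikodym derivative of a charge, the function used here is
    everywhere finite and nonnegative. *)
Definition RN_density mu la (x : T) : R :=
  fine (Radon_Nikodym_SigmaFinite.f mu la x).

Lemma RN_densityE mu la x : mu `<< la ->
  (RN_density mu la x)%:E = Radon_Nikodym_SigmaFinite.f mu la x.
Proof. by move=> mula; rewrite fineK// Radon_Nikodym_SigmaFinite.f_fin_num. Qed.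

Lemma RN_densityP mu la : mu `<< la -> has_density mu la (RN_density mu la).
Proof.
move=> mula; split.
- apply: measurableT_comp => //.
  exact: measurable_int (Radon_Nikodym_SigmaFinite.f_integrable mula).
- by move=> x; rewrite fine_ge0// Radon_Nikodym_SigmaFinite.f_ge0.
- move=> F F0 mF; rewrite -(Radon_Nikodym_SigmaFinite.change_of_variables mula)//.
  by apply: eq_integral => x _; rewrite RN_densityE.
Qed.

Section has_density.
Variables (mu la : {finite_measure set T -> \bar R}) (w : T -> R).
Hypothesis muw : has_density mu la w.

Lemma density_measurable : measurable_fun [set: T] w.
Proof. by case: muw. Qed.

Lemma density_ge0 x : (0 <= w x)%R.
Proof. by case: muw. Qed.

Lemma density_int F : (forall x, 0 <= F x) -> measurable_fun [set: T] F ->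
  \int[mu]_x F x = \int[la]_x (F x * (w x)%:E).
Proof. by case: muw => _ _; exact. Qed.

Lemma density_set (A : set T) : measurable A -> mu A = \int[la]_(x in A) (w x)%:E.
Proof.
move=> mA; rewrite -(setIT A) -integral_indic// density_int//; last first.
  exact/measurable_EFinP.
rewrite setIT [RHS]integral_mkcond; apply: eq_integral => x _.
by rewrite epatch_indic muleC.
Qed.

Lemma density_integrable : la.-integrable [set: T] (EFin \o w).
Proof.
apply/integrableP; split; first exact/measurable_EFinP/density_measurable.
under eq_integral do rewrite /= ger0_norm ?density_ge0//.
by rewrite -density_set// fin_num_fun_lty//; exact: fin_num_measure.
Qed.

End has_density.

(** The density has integral zero over the exceptional null set of mu, so it
    vanishes la-almost everywhere on that set. *)
Lemma ae_density_pos mu la w (P : T -> Prop) : has_density mu la w ->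
  {ae mu, forall x, P x} -> {ae la, forall x, (0 < w x)%R -> P x}.
Proof.
move=> muw [N [mN N0 NP]].
have mw := density_measurable muw.
have : {ae la, forall x, N x -> (w x)%:E = 0}.
  apply: (@ae_eq_integral_abs _ _ _ la _ mN (EFin \o w) _).1.
    by apply/measurable_EFinP; exact: measurable_funTS.
  under eq_integral do rewrite /= ger0_norm ?(density_ge0 muw)//.
  by rewrite -(density_set muw).
apply: filterS => x wN w0; apply: contrapT => nP.
by have := wN (NP _ nP); case => w00; move: w0; rewrite w00 ltxx.
Qed.

Lemma ae_dominates mu la (P : T -> Prop) : mu `<< la ->
  {ae la, forall x, P x} -> {ae mu, forall x, P x}.
Proof.
move=> /null_content_dominatesP mula [N [mN N0 NP]].
by exists N; split => //; exact: mula.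
Qed.

Lemma ae_density_gt0 mu la w : has_density mu la w ->
  {ae mu, forall x, (0 < w x)%R}.
Proof.
move=> muw; have mw := density_measurable muw.
exists [set x | w x = 0%R]; split.
- by rewrite -[X in measurable X]setTI; exact: (mw measurableT [set 0%R]).
- rewrite (density_set muw); last first.
    by rewrite -[X in measurable X]setTI; exact: (mw measurableT [set 0%R]).
  by apply: integral0_eq => x /= ->.
- move=> x /= /negP; rewrite -leNgt => w0; apply/eqP.
  by rewrite eq_le w0 (density_ge0 muw).
Qed.

(** Over the set where the inequality between the densities fails, both measures
    agree, so that this set is null. *)
Lemma ae_density_le mu0 mu1 la w0 w1 (c : R) : (0 <= c)%R ->
  has_density mu0 la w0 -> has_density mu1 la w1 ->
  (forall A, measurable A -> c%:E * mu0 A <= mu1 A) ->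
  {ae la, forall x, (c * w0 x <= w1 x)%R}.
Proof.
move=> c0 d0 d1 le01.
have m0 := density_measurable d0; have m1 := density_measurable d1.
pose A := [set x | (w1 x < c * w0 x)%R].
have mA : measurable A.
  have mlt : measurable_fun [set: T] (fun x => w1 x < c * w0 x)%R.
    by apply: measurable_fun_ltr => //; exact: measurable_funM.
  rewrite -[A]setTI; exact: (mlt measurableT [set true]).
have ae0 : {ae la, forall x, A x -> (c * w0 x - w1 x)%:E = 0}.
  apply: (@ae_eq_integral_abs _ _ _ la _ mA (fun x => (c * w0 x - w1 x)%:E) _).1.
    apply/measurable_EFinP/measurable_funTS.
    by apply: measurable_funB => //; exact: measurable_funM.
  transitivity (\int[la]_(x in A) (c%:E * (w0 x)%:E - (w1 x)%:E)).
    apply: eq_integral => x /[!inE] Ax.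
    by rewrite /= ger0_norm ?EFinB ?EFinM// subr_ge0 ltW.
  have i0 : la.-integrable A (EFin \o w0).
    exact: integrableS (density_integrable d0).
  have i1 : la.-integrable A (EFin \o w1).
    exact: integrableS (density_integrable d1).
  rewrite integralB//; last exact: integrableZl.
  rewrite integralZl// -(density_set d0)// -(density_set d1)//.
  have f1 : mu1 A \is a fin_num by exact: fin_num_measure.
  suff -> : c%:E * mu0 A = mu1 A by rewrite subee.
  apply/eqP; rewrite eq_le le01//=.
  rewrite (density_set d0)// (density_set d1)// -integralZl//.
  apply: ge0_le_integral => //.
  - by move=> x _; rewrite lee_fin (density_ge0 d1).
  - by apply/measurable_EFinP; exact: measurable_funTS.
  - apply/measurable_EFinP/measurable_funTS; exact: measurable_funM.
  - by move=> x Ax; rewrite lee_fin ltW.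
apply: filterS ae0 => x xA0; rewrite leNgt; apply/negP => Ax.
by have [/eqP] := xA0 Ax; rewrite subr_eq0 => /eqP e; move: Ax; rewrite e ltxx.
Qed.

End density.

Section convergence_in_measure.
Context d (T : measurableType d) (R : realType).
Implicit Types mu nu la : {finite_measure set T -> \bar R}.
Local Open Scope ereal_scope.

(** Borel-Cantelli lemma, for indices g k at which the deviations larger than
    2 ^- (k + 1) have measure at most 2 ^- (k + 1). *)
Lemma cvg_in_measure_ae nu (u : nat -> T -> \bar R) (u0 : T -> \bar R) :
  (forall n, measurable_fun [set: T] (u n)) -> measurable_fun [set: T] u0 ->
  (forall x, u0 x \is a fin_num) ->
  (forall e : R, (0 < e)%R ->
    nu [set x | e%:E <= `|u n x - u0 x|] @[n --> \oo] --> 0) ->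
  exists2 g : nat -> nat, g n @[n --> \oo] --> \oo &
    {ae nu, forall x, u (g n) x @[n --> \oo] --> u0 x}.
Proof.
move=> mu_ mu0 fu0 cvgu.
pose e k : R := (1 / (2 ^ k.+1)%:R)%R.
have e0 k : (0 < e k)%R by rewrite divr_gt0// ltr0n expn_gt0.
pose B k n := [set x | (e k)%:E <= `|u n x - u0 x|].
have mB k n : measurable (B k n).
  rewrite -[B k n]setTI; apply: emeasurable_fun_c_infty => //.
  by apply: measurableT_comp => //; exact: emeasurable_funB.
have /choice[g gP] : forall k, exists n, (k <= n)%N /\ nu (B k n) <= (e k)%:E.
  move=> k; have /fine_cvgP[_ /cvgrPdist_le/(_ _ (e0 k))[N _ NP]] := cvgu _ (e0 k).
  exists (maxn k N); split; first exact: leq_maxl.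
  have := NP (maxn k N) (leq_maxr _ _); rewrite sub0r normrN /= ger0_norm?fine_ge0//.
  by move=> h; rewrite -(fineK (fin_num_measure nu _ (mB _ _))) lee_fin.
exists g.
  move=> A [M _ MA]; exists M => // n /= Mn; apply: MA => /=.
  exact: leq_trans Mn (gP n).1.
exists (lim_sup_set (fun k => B k (g k))); split.
- by apply: bigcapT_measurable => k; exact: bigcup_measurable.
- apply: lim_sup_set_cvg0 => //.
  apply: (@le_lt_trans _ _ 1%:E); last exact: ltry.
  rewrite (le_trans _ (@epsilon_trick0 R 1%R xpredT _))//.
  by apply: lee_nneseries => // k _; exact: (gP k).2.
- move=> x /= ncv; apply: contrapT => /existsNP[N] /not_implyP[_ nB].
  apply: ncv.
  apply: (@sube_cvg0 _ _ _ _ (fun k => u (g k) x) _ (fu0 x)).1.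
  apply/cvg_abse0P.
  apply: (@squeeze_cvge _ _ _ _ (cst 0) _ (fun k => (e k)%:E)) => //; last first.
  - apply/cvg_EFin; first exact: nearW.
    have := @cvg_geometric R 2^-1 2^-1.
    rewrite ger0_norm// invf_lt1// ltr1n => /(_ isT); apply: cvg_trans.
    rewrite [X in X @ _](_ : _ = geometric 2^-1 2^-1)//.
    by apply/funext => k; rewrite /= /e natrX div1r exprS invfM exprVn.
  - exact: cvg_cst.
  - exists N => // k /= Nk; rewrite abse_ge0/= leNgt; apply/negP => Bk.
    by apply: nB; exists k => //; exact: ltW.
Qed.

End convergence_in_measure.

Section finite_measure_add.
Context d (T : measurableType d) (R : realType).
Variables nu la : {finite_measure set T -> \bar R}.
Local Open Scope ereal_scope.

Definition fin_measure_add : set T -> \bar R := measure_add nu la.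

HB.instance Definition _ := Measure.on fin_measure_add.

Let fin_measure_add_fin : fin_num_fun fin_measure_add.
Proof.
move=> A mA; rewrite /fin_measure_add measure_addE fin_numD.
by rewrite !fin_num_measure.
Qed.

HB.instance Definition _ := Measure_isFinite.Build _ _ _ fin_measure_add
  fin_measure_add_fin.

Lemma fin_measure_addE A : fin_measure_add A = nu A + la A.
Proof. exact: measure_addE. Qed.

Lemma fin_measure_add_dominatesl : nu `<< fin_measure_add.
Proof.
apply/null_content_dominatesP => A mA sA0.
have /eqP : nu A + la A = 0 by exact: etrans (esym (fin_measure_addE A)) sA0.
by rewrite padde_eq0 ?measure_ge0// => /andP[/eqP].
Qed.

Lemma fin_measure_add_dominatesr : la `<< fin_measure_add.
Proof.
apply/null_content_dominatesP => A mA sA0.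
have /eqP : nu A + la A = 0 by exact: etrans (esym (fin_measure_addE A)) sA0.
by rewrite padde_eq0 ?measure_ge0// => /andP[_ /eqP].
Qed.

End finite_measure_add.

Lemma ae_and d (T : measurableType d) (R : realType)
    (mu : {measure set T -> \bar R}) (P Q : T -> Prop) :
  {ae mu, forall x, P x} -> {ae mu, forall x, Q x} ->
  {ae mu, forall x, P x /\ Q x}.
Proof. by apply: filterS2. Qed.

Section RN_density_cvg.
Context d (T : measurableType d) (R : realType).
Implicit Types mu nu la : {finite_measure set T -> \bar R}.
Local Open Scope ereal_scope.

Lemma RN_density_chain mu nu la : mu `<< nu -> nu `<< la ->
  {ae la, forall x, RN_density mu la x = (RN_density mu nu x * RN_density nu la x)%R}.
Proof.
move=> munu nula; have mula := null_dominates_trans munu nula.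
apply: filterS (Radon_Nikodym_SigmaFinite.chain_rule munu nula measurableT).
move=> x /(_ I); rewrite -!RN_densityE// => e; apply: EFin_inj.
by rewrite EFinM e /= !RN_densityE.
Qed.

(** Over the measure nu + la, the density of each mu n factors by the chain rule
    both through nu and through la. At a point where the density of la is positive, the
    densities with respect to la are thus those with respect to nu times a common
    factor, and this factor vanishes wherever the convergence over nu is unknown. *)
Lemma RN_density_cvg_ae nu la (mu : nat -> {finite_measure set T -> \bar R}) mu0 :
  mu0 `<< nu -> (forall n, mu n `<< nu) ->
  mu0 `<< la -> (forall n, mu n `<< la) ->
  {ae nu, forall x, RN_density (mu n) nu x @[n --> \oo] --> RN_density mu0 nu x} ->
  {ae la, forall x, RN_density (mu n) la x @[n --> \oo] --> RN_density mu0 la x}.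
Proof.
move=> mu0nu munu mu0la mula cvgnu.
pose si : {finite_measure set T -> \bar R} := fin_measure_add nu la.
have nusi : nu `<< si by exact: fin_measure_add_dominatesl.
have lasi : la `<< si by exact: fin_measure_add_dominatesr.
have chain (kappa : {finite_measure set T -> \bar R}) : kappa `<< nu -> kappa `<< la -> {ae la, forall x,
    (RN_density kappa nu x * RN_density nu si x =
     RN_density kappa la x * RN_density la si x)%R}.
  move=> kappanu kappala; apply: (ae_dominates lasi).
  apply: filterS2 (RN_density_chain kappanu nusi) (RN_density_chain kappala lasi).
  by move=> x <- <-.
have la0cvg := ae_and (ae_density_gt0 (RN_densityP lasi))
  (ae_dominates lasi (ae_density_pos (RN_densityP nusi) cvgnu)).
have chain0n := ae_and (chain _ mu0nu mu0la)
  (ae_foralln (fun n => chain _ (munu n) (mula n))).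
apply: filterS2 chain0n la0cvg => x [chain0 chainn] [la0 cvgx].
have la0' : RN_density la si x != 0%R by rewrite gt_eqF.
have laE (kappa : {finite_measure set T -> \bar R}) : (RN_density kappa nu x * RN_density nu si x =
     RN_density kappa la x * RN_density la si x)%R ->
    RN_density kappa la x =
    (RN_density kappa nu x * (RN_density nu si x / RN_density la si x))%R.
  by move=> e; rewrite mulrA e mulfK.
rewrite (laE _ chain0); under eq_fun do rewrite (laE _ (chainn _)).
have : (0 <= RN_density nu si x)%R by exact: density_ge0 (RN_densityP nusi) x.
rewrite le_eqVlt => /predU1P[<-|nu0]; last by apply: cvgMl; exact: cvgx.
by rewrite mul0r mulr0; under eq_fun do rewrite mulr0; exact: cvg_cst.
Qed.

Lemma cvg_in_measure_density_ae nu la (mu : nat -> {finite_measure set T -> \bar R}) mu0 :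
  mu0 `<< nu -> (forall n, mu n `<< nu) ->
  mu0 `<< la -> (forall n, mu n `<< la) ->
  (forall e : R, (0 < e)%R ->
    nu [set x | e%:E <= `|Radon_Nikodym (charge_of_finite_measure (mu n)) nu x -
      Radon_Nikodym (charge_of_finite_measure mu0) nu x|] @[n --> \oo] --> 0) ->
  exists2 g : nat -> nat, g n @[n --> \oo] --> \oo &
    {ae la, forall x, RN_density (mu (g n)) la x @[n --> \oo] --> RN_density mu0 la x}.
Proof.
move=> mu0nu munu mu0la mula cvgnu.
have [//|//|x|g goo gnu] := cvg_in_measure_ae _ _ _ cvgnu.
- move=> n; exact: measurable_int (@Radon_Nikodym_integrable _ _ _
    (charge_of_finite_measure (mu n)) nu (munu n)).
- by apply: Radon_Nikodym_fin_num; exact: mu0nu.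
exists g => //; apply: (RN_density_cvg_ae mu0nu) => //.
have aeE (kappa : {finite_measure set T -> \bar R}) : kappa `<< nu -> {ae nu, forall x, (RN_density kappa nu x)%:E =
    Radon_Nikodym (charge_of_finite_measure kappa) nu x}.
  move=> kappanu; apply: filterS (ae_eq_Radon_Nikodym_SigmaFinite kappanu measurableT).
  by move=> x /(_ I) <-; rewrite RN_densityE.
apply: filterS3 gnu (aeE _ mu0nu) (ae_foralln (fun n => aeE _ (munu (g n)))).
move=> x cvgx e0 en; move: cvgx; rewrite -e0.
by under eq_fun do rewrite -en; move=> /fine_cvgP[_].
Qed.

End RN_density_cvg.

(** * The topology of the dual group *)

Section complex_modulus.
Context {R : realType}.
Implicit Types z w : R[i].
Local Open Scope complex_scope.

Lemma normcE z : Normc.normc z = Num.sqrt (complex.Re z ^+ 2 + complex.Im z ^+ 2).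
Proof. by case: z. Qed.

Lemma normr_normc z : `|z| = (Normc.normc z)%:C.
Proof. by case: z => a b; rewrite normc_def. Qed.

Lemma normc_ge0 z : 0 <= Normc.normc z.
Proof. by rewrite normcE sqrtr_ge0. Qed.

Lemma normr_Re_le z : `|complex.Re z| <= Normc.normc z.
Proof.
by rewrite normcE -sqrtr_sqr ler_wsqrtr// lerDl sqr_ge0.
Qed.

Lemma normr_Im_le z : `|complex.Im z| <= Normc.normc z.
Proof.
by rewrite normcE -sqrtr_sqr ler_wsqrtr// lerDr sqr_ge0.
Qed.

Lemma normc_real (x : R) : Normc.normc x%:C = `|x|.
Proof. by rewrite normcE /= expr0n addr0 sqrtr_sqr. Qed.

Lemma normc_distC z w : Normc.normc (z - w) = Normc.normc (w - z).
Proof. by apply: (@complexI R); rewrite -!normr_normc distrC. Qed.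

Lemma normc_distrr z : Normc.normc (z - z) = 0.
Proof. by rewrite subrr; exact: Normc.normc0. Qed.

Lemma ler_normcD z w :
  Normc.normc (z + w) <= Normc.normc z + Normc.normc w.
Proof. by rewrite -lecR rmorphD/= -!normr_normc ler_normD. Qed.

End complex_modulus.

Section initial_pointwise.
Context {I : choiceType} {S : choiceType} {V : topologicalType}.
Variable f : S -> {ptws I -> V}.

Lemma initial_ptws_eval (i : I) (s : initial_topology f) (U : set V) :
  nbhs (f s i) U -> nbhs s [set t : initial_topology f | U (f t i)].
Proof.
move=> nU; have := @proj_continuous I (fun=> V) i (f s) U nU.
exact: (@initial_continuous _ _ f s).
Qed.

Lemma initial_ptws_cvg (F : set_system (initial_topology f))
    (s : initial_topology f) : Filter F ->
  (forall i (U : set V), nbhs (f s i) U -> F [set t | U (f t i)]) -> F --> s.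
Proof.
move=> FF Fs A /= [_ [[B Bop <-] Bs sBA]].
have /(_ B) : (f @ F) --> (f s : {ptws I -> V}).
  apply/cvg_sup => i C /= [_ [[D Dop <-] Ds sDC]].
  have Ds' : nbhs (f s i) D by exact: open_nbhs_nbhs.
  by have := Fs i D Ds'; apply: (@filterS _ F) => t Dt; exact: sDC.
have Bs' : nbhs (f s : {ptws I -> V}) B by exact: open_nbhs_nbhs.
by move=> /(_ Bs') FB; exact: (@filterS _ F _ _ _ sBA FB).
Qed.

End initial_pointwise.

Section dual_topology.
Context {R : realType} {G : zmodType}.
Local Notation Gamma := (dual R G).
Local Notation C := (R[i] : numFieldType).
Implicit Types (g h : Gamma) (x : G).

Lemma dual_eqP g h : (forall x, g x = h x) -> g = h.
Proof.
case: g h => [g g1 gD] [h h1 hD] /= gh.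
have {}gh : g = h by exact/funext.
by subst h; congr Dual; exact: Prop_irrelevance.
Qed.

Lemma dual_normc g x : Normc.normc (g x) = 1.
Proof. by have := dual_norm1 g x; rewrite normr_normc => -[]. Qed.

Lemma dual0 g : g 0 = 1.
Proof.
have g0 : g 0 != 0 by rewrite -normr_eq0 dual_norm1 oner_eq0.
by apply: (mulfI g0); rewrite -dualD addr0 mulr1.
Qed.

Lemma dualN g x : g (- x) = ((g x)^*)%C.
Proof.
have gx0 : g x != 0 by rewrite -normr_eq0 dual_norm1 oner_eq0.
apply: (mulfI gx0); rewrite -dualD subrr dual0.
by rewrite -sqr_normc dual_norm1 expr1n.
Qed.

Definition dual_inv_fun g x : R[i] := ((g x)^*)%C.

Lemma dual_inv_norm1 g x : `|dual_inv_fun g x| = 1.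
Proof. by rewrite /dual_inv_fun normcJ dual_norm1. Qed.

Lemma dual_invD g x y :
  dual_inv_fun g (x + y) = dual_inv_fun g x * dual_inv_fun g y.
Proof. by rewrite /dual_inv_fun dualD rmorphM. Qed.

Definition dual_inv g : Gamma := Dual (dual_inv_norm1 g) (dual_invD g).

Lemma dual_mulK g : cancel (dual_mul g) (dual_mul (dual_inv g)).
Proof.
move=> h; apply: dual_eqP => x; rewrite /= mulrA [_ * g x]mulrC -sqr_normc.
by rewrite dual_norm1 expr1n mul1r.
Qed.

Lemma dual_mulVK g : cancel (dual_mul (dual_inv g)) (dual_mul g).
Proof.
move=> h; apply: dual_eqP => x; rewrite /= mulrA -sqr_normc.
by rewrite dual_norm1 expr1n mul1r.
Qed.

Lemma ball_normc (z w : C) (e : R) :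
  ball z e%:C%C w <-> Normc.normc (z - w) < e.
Proof. by rewrite -ball_normE /ball_ /= normr_normc ltcR. Qed.

Lemma near_dual g x (e : R) : 0 < e ->
  nbhs g [set h : Gamma | Normc.normc (h x - g x) < e].
Proof.
move=> e0.
have e0' : 0 < e%:C%C by rewrite ltcR.
have := @nbhsx_ballx C C (g x) _ e0'.
move=> /(@initial_ptws_eval G _ C (@dual_fun R G) x g).
by apply: filterS => h /ball_normc; rewrite normc_distC.
Qed.

Lemma near_dualS g x (e : R) (P : set Gamma) : 0 < e ->
  (forall h : Gamma, Normc.normc (h x - g x) < e -> P h) -> nbhs g P.
Proof. by move=> e0 eP; exact: (@filterS _ (nbhs g) _ _ P eP (near_dual g x e0)). Qed.

Lemma cvg_dual (F : set_system Gamma) g : Filter F ->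
  (forall x (e : R), 0 < e -> F [set h : Gamma | Normc.normc (h x - g x) < e]) ->
  F --> g.
Proof.
move=> FF Fg; apply: (@initial_ptws_cvg G _ C (@dual_fun R G)) => x U.
move=> /nbhs_ballP[e /= e0 eU].
apply: filterS (Fg x (complex.Re e) _) => [h hge|].
  apply: eU.
  have -> : e = (complex.Re e)%:C%C by rewrite RRe_real// gtr0_real.
  by apply/ball_normc; rewrite normc_distC.
by move: e0; rewrite ltcE => /andP[].
Qed.

(** Compact sets are closed in a Hausdorff space; this makes them measurable. *)
Lemma dual_hausdorff : hausdorff_space Gamma.
Proof.
move=> g h gh; apply: dual_eqP => x; apply/eqP; rewrite -subr_eq0; apply/eqP.
apply: Normc.eq0_normc; apply: contrapT => /eqP n0.
have e0 : 0 < Normc.normc (g x - h x) / 2.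
  by rewrite divr_gt0// lt_neqAle eq_sym n0 normc_ge0.
have [k [/= kg kh]] := gh _ _ (near_dual g x e0) (near_dual h x e0).
have : Normc.normc (g x - h x) <= Normc.normc (g x - k x) + Normc.normc (k x - h x).
  by rewrite -(subrKA (k x)) ler_normcD.
rewrite [X in _ <= X + _]normc_distC leNgt => /negP; apply.
by rewrite [ltRHS]splitr ltrD.
Qed.

Lemma dual_compact_measurable (K : set Gamma) : compact K -> measurable K.
Proof.
move=> cK; rewrite -[K]setCK; apply: measurableC; apply: sub_sigma_algebra.
by apply: closed_openC; apply: compact_closed => //; exact: dual_hausdorff.
Qed.

Lemma dual_open_measurable (U : set Gamma) : open U -> measurable U.
Proof. exact: sub_sigma_algebra. Qed.

Lemma dual_continuous_measurable (f : Gamma -> R) :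
  continuous f -> measurable_fun [set: Gamma] f.
Proof.
move=> /continuousP cf; apply: (measurability _ (RGenOpens.measurableE R)).
move=> _ [_ [a [b ->]] <-]; rewrite setTI; apply: dual_open_measurable.
by apply: cf; exact: interval_open.
Qed.

Lemma measurable_dual_Re x : measurable_fun [set: Gamma] (fun g => complex.Re (g x)).
Proof.
apply: dual_continuous_measurable => g U /nbhs_ballP[e /= e0 eU].
apply: (@near_dualS g x e) => // h hge; apply: eU; rewrite -ball_normE /ball_ /=.
by rewrite distrC -raddfB; apply: le_lt_trans hge; exact: normr_Re_le.
Qed.

Lemma measurable_dual_Im x : measurable_fun [set: Gamma] (fun g => complex.Im (g x)).
Proof.
apply: dual_continuous_measurable => g U /nbhs_ballP[e /= e0 eU].
apply: (@near_dualS g x e) => // h hge; apply: eU; rewrite -ball_normE /ball_ /=.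
by rewrite distrC -raddfB; apply: le_lt_trans hge; exact: normr_Im_le.
Qed.

Lemma continuous_dual_mul g : continuous (dual_mul g : Gamma -> Gamma).
Proof.
move=> h; apply: (cvg_dual (fmap_filter _ (@nbhs_filter Gamma h))) => x e e0.
apply: (@near_dualS h x e) => // k /=.
by rewrite -mulrBr Normc.normcM dual_normc mul1r.
Qed.

Lemma measurable_dual_mul g : measurable_fun [set: Gamma] (dual_mul g : Gamma -> Gamma).
Proof.
apply: (measurability (@open (dual R G))) => //.
move=> _ [U oU <-]; rewrite setTI; apply: dual_open_measurable.
by have /continuousP := @continuous_dual_mul g; exact.
Qed.

End dual_topology.

(** * Trigonometric polynomials and the Haar measure *)

Lemma bounded_integrable d (T : measurableType d) (R : realType)
    (mu : {finite_measure set T -> \bar R}) (f : T -> R) (M : R) :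
  measurable_fun [set: T] f -> (forall x, `|f x| <= M) ->
  mu.-integrable [set: T] (EFin \o f).
Proof.
move=> mf fM; apply: measurable_bounded_integrable => //.
  by rewrite fin_num_fun_lty//; exact: fin_num_measure.
exists M; split; first exact: num_real.
by move=> N MN x _; exact: le_trans (fM x) (ltW MN).
Qed.

Section trigonometric_polynomials.
Context {R : realType} {G : zmodType}.
Local Notation Gamma := (dual R G).
Implicit Types (g h : Gamma) (x : G) (S : set G) (f tau : Gamma -> R[i]) (P Q : Gamma -> R).

Lemma trig_poly0 S : trig_poly S (fun=> 0 : R[i]).
Proof.
exists 0%N, (fun=> 0), (fun=> 0); split; first by case.
by apply/funext => g; rewrite big_ord0.
Qed.

Lemma trig_poly_addmono S f a x : trig_poly S f -> S x ->
  trig_poly S (fun g => f g + a * g x).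
Proof.
move=> [n [b [y [Sy ->]]]] Sx.
exists n.+1, (fun i => if unlift ord0 i is Some j then b j else a),
  (fun i => if unlift ord0 i is Some j then y j else x); split.
  by move=> i; case: unliftP => [j _|_].
apply/funext => g; rewrite big_ord_recl unlift_none addrC; congr (_ + _).
by apply: eq_bigr => i _; rewrite liftK.
Qed.

(** Lets the properties of trigonometric polynomials be proved one character at a
    time, instead of by manipulations of indexed sums. *)
Lemma trig_poly_ind S (Q : (Gamma -> R[i]) -> Prop) : Q (fun=> 0) ->
  (forall f a x, trig_poly S f -> Q f -> S x -> Q (fun g => f g + a * g x)) ->
  forall tau, trig_poly S tau -> Q tau.
Proof.
move=> Q0 QD tau [n [a [x [Sx ->]]]]; elim: n => [|n IHn] in a x Sx *.
  by under eq_fun do rewrite big_ord0.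
under eq_fun do rewrite big_ord_recr/=.
apply: QD (IHn _ _ _) _ => //.
by exists n, (fun i => a (widen_ord (leqnSn n) i)), (fun i => x (widen_ord (leqnSn n) i)).
Qed.

Lemma trig_poly_mono S a x : S x -> trig_poly S (fun g => a * g x).
Proof.
move=> Sx; have := trig_poly_addmono a (trig_poly0 S) Sx.
by under eq_fun do rewrite add0r.
Qed.

Lemma trig_polyD S f1 f2 : trig_poly S f1 -> trig_poly S f2 ->
  trig_poly S (fun g => f1 g + f2 g).
Proof.
move=> tf1; move: f2; apply: trig_poly_ind => [|f2 a x _ tf12 Sx].
  by under eq_fun do rewrite addr0.
by under eq_fun do rewrite addrA; exact: trig_poly_addmono.
Qed.

Lemma trig_polyZ S a f : trig_poly S f -> trig_poly S (fun g => a * f g).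
Proof.
move: f; apply: trig_poly_ind => [|f b x _ tf Sx].
  by under eq_fun do rewrite mulr0; exact: trig_poly0.
by under eq_fun do rewrite mulrDr mulrA; exact: trig_poly_addmono.
Qed.

Lemma trig_polyM f1 f2 : trig_poly [set: G] f1 -> trig_poly [set: G] f2 ->
  trig_poly [set: G] (fun g => f1 g * f2 g).
Proof.
move=> tf1; move: f2; apply: trig_poly_ind => [|f2 b y _ tf12 _].
  by under eq_fun do rewrite mulr0; exact: trig_poly0.
under eq_fun do rewrite mulrDr.
apply: trig_polyD tf12 _; move: f1 tf1.
apply: trig_poly_ind => [|f1 a x _ tf1 _].
  by under eq_fun do rewrite mul0r; exact: trig_poly0.
under eq_fun do rewrite mulrDl mulrACA -dualD.
exact: trig_poly_addmono.
Qed.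

(** Only the character at 0, which is constant, is missing from the space spanned by
    the characters at non-zero points. *)
Lemma trig_poly_split f : trig_poly [set: G] f ->
  exists a0, trig_poly [set x | x != 0] (fun g => f g - a0).
Proof.
move: f; apply: trig_poly_ind => [|f a x _ [a0 ta0] _].
  exists 0; rewrite [X in trig_poly _ X](_ : _ = fun=> 0); first exact: trig_poly0.
  by apply/funext => g; rewrite subr0.
have [->|x0] := eqVneq x 0.
  exists (a0 + a); rewrite [X in trig_poly _ X](_ : _ = (fun g => f g - a0))//.
  by apply/funext => g; rewrite dual0 mulr1; ring.
exists a0; rewrite [X in trig_poly _ X](_ : _ = (fun g => (f g - a0) + a * g x)).
  exact: trig_poly_addmono.
by apply/funext => g; ring.
Qed.

Lemma trig_poly_bounded S tau : trig_poly S tau ->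
  exists M : R, forall g, Normc.normc (tau g) <= M.
Proof.
move: tau; apply: trig_poly_ind => [|f a x _ [M fM] _].
  by exists 0 => g; rewrite Normc.normc0.
exists (M + Normc.normc a) => g; rewrite (le_trans (ler_normcD _ _))// lerD//.
by rewrite Normc.normcM dual_normc mulr1.
Qed.

Lemma cmeasurable_trig_poly S tau : trig_poly S tau -> cmeasurable tau.
Proof.
move: tau; apply: trig_poly_ind => [|f a x _ [mRe mIm] _].
  by split; exact: measurable_cst.
split.
- rewrite [X in measurable_fun _ X](_ : _ = fun g => complex.Re (f g) +
     (complex.Re a * complex.Re (g x) - complex.Im a * complex.Im (g x))).
    apply: measurable_funD => //; apply: measurable_funB; apply: measurable_funM => //.
      exact: measurable_dual_Re.
    exact: measurable_dual_Im.
  by apply/funext => g; case: (f g) a (g x) => [f1 f2] [a1 a2] [g1 g2].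
- rewrite [X in measurable_fun _ X](_ : _ = fun g => complex.Im (f g) +
     (complex.Re a * complex.Im (g x) + complex.Im a * complex.Re (g x))).
    apply: measurable_funD => //; apply: measurable_funD; apply: measurable_funM => //.
      exact: measurable_dual_Im.
    exact: measurable_dual_Re.
  by apply/funext => g; case: (f g) a (g x) => [f1 f2] [a1 a2] [g1 g2].
Qed.

(** Real-valued functions suffice for the approximation, and they allow to use
    the real integration theory. *)
Definition real_trig_poly P := trig_poly [set: G] (fun g => (P g)%:C%C).

Lemma real_trig_poly_cst c : real_trig_poly (fun=> c).
Proof.
rewrite /real_trig_poly [X in trig_poly _ X](_ : _ = fun g => c%:C%C * g 0).
  exact: trig_poly_mono.
by apply/funext => g; rewrite dual0 mulr1.
Qed.

Lemma real_trig_polyD P Q : real_trig_poly P -> real_trig_poly Q ->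
  real_trig_poly (fun g => P g + Q g).
Proof.
move=> tP tQ; rewrite /real_trig_poly; under eq_fun do rewrite rmorphD.
exact: trig_polyD.
Qed.

Lemma real_trig_polyM P Q : real_trig_poly P -> real_trig_poly Q ->
  real_trig_poly (fun g => P g * Q g).
Proof.
move=> tP tQ; rewrite /real_trig_poly; under eq_fun do rewrite rmorphM.
exact: trig_polyM.
Qed.

Lemma real_trig_poly_Re a x : real_trig_poly (fun g => complex.Re (a * g x)).
Proof.
rewrite /real_trig_poly [X in trig_poly _ X](_ : _ = fun g =>
    a / 2%:R * g x + (a^*)%C / 2%:R * g (- x)).
  by apply: trig_polyD; exact: trig_poly_mono.
by apply/funext => g; rewrite ReJ_add rmorphM/= dualN mulrDl; ring.
Qed.

Lemma real_trig_poly_bounded P : real_trig_poly P -> exists M : R, forall g, `|P g| <= M.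
Proof.
by move=> /trig_poly_bounded[M PM]; exists M => g; rewrite -normc_real.
Qed.

Lemma real_trig_poly_measurable P : real_trig_poly P -> measurable_fun [set: Gamma] P.
Proof. by move=> /cmeasurable_trig_poly[]. Qed.

End trigonometric_polynomials.

Section orthogonality.
Context {R : realType} {G : zmodType}.
Local Notation Gamma := (dual R G).
Variable lambda : {finite_measure set Gamma -> \bar R}.
Hypothesis haar : normalized_haar lambda.
Local Open Scope ereal_scope.

Lemma haar_integralM (g : Gamma) (f : Gamma -> R) (M : R) :
  measurable_fun [set: Gamma] f -> (forall h, `|f h| <= M)%R ->
  \int[lambda]_h (f (dual_mul g h))%:E = \int[lambda]_h (f h)%:E.
Proof.
move=> mf fM; have mg := measurable_dual_mul g.
transitivity (\int[pushforward lambda (dual_mul g)]_h (f h)%:E).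
  rewrite integral_pushforward//; first exact/measurable_EFinP.
  apply: (@bounded_integrable _ _ _ _ _ M) => //.
  exact: measurableT_comp.
apply: eq_measure_integral => A mA _; case: haar => _ _ inv.
rewrite /pushforward /= -(inv (dual_inv g) A mA); congr (lambda _).
apply/seteqP; split => [h Ah|_ [h Ah <-]] /=.
  by exists (dual_mul g h) => //; rewrite dual_mulK.
by rewrite dual_mulVK.
Qed.

(** Translation by g multiplies the character by g x, and leaves its integral
    unchanged. As g x != 1, every multiple of the character has the form
    (b - b * g x) * h x, whose integral is zero. *)
Lemma haar_integral_character (a : R[i]) (x : G) :
  (exists g : Gamma, g x != 1%R) ->
  \int[lambda]_h (complex.Re (a * h x))%:E = 0.
Proof.
move=> [g gx1]; pose b := (a / (1 - g x))%R.
have mb c : measurable_fun [set: Gamma] (fun h => complex.Re (c * h x)%R).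
  exact: real_trig_poly_measurable (real_trig_poly_Re c x).
have bb (c : R[i]) (h : Gamma) : (`|complex.Re (c * h x)| <= Normc.normc c)%R.
  by rewrite (le_trans (normr_Re_le _))// Normc.normcM dual_normc mulr1.
have ib c : lambda.-integrable [set: Gamma] (fun h => (complex.Re (c * h x))%:E).
  exact: (bounded_integrable _ (mb c) (bb c)).
have bE h : complex.Re (a * h x)%R = (complex.Re (b * h x) - complex.Re (b * g x * h x))%R.
  rewrite -raddfB/= -mulrBl -{1}[b]mulr1 -mulrBr /b divfK//.
  by rewrite subr_eq0 eq_sym.
under eq_integral do rewrite bE EFinB.
rewrite integralB//; try exact: ib.
rewrite -(haar_integralM g (mb b) (bb b)).
rewrite [X in X - _](eq_integral (fun h : Gamma => (complex.Re (b * g x * h x)%R)%:E)).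
  by rewrite subee//; exact/integrable_fin_num/ib.
by move=> h _; rewrite /= mulrA.
Qed.

Lemma haar_integral_trig_poly (tau : Gamma -> R[i]) :
  (forall x : G, x != 0%R -> exists g : Gamma, g x != 1%R) ->
  trig_poly [set x | x != 0%R] tau ->
  \int[lambda]_g (complex.Re (tau g))%:E = 0.
Proof.
move=> sep; move: tau.
apply: trig_poly_ind => [|f a x tf f0 x0]; first by rewrite integral0.
have iRe tau : trig_poly [set x | x != 0%R] tau ->
    lambda.-integrable [set: Gamma] (fun g => (complex.Re (tau g))%:E).
  move=> ttau; have [M tauM] := trig_poly_bounded ttau.
  apply: (@bounded_integrable _ _ _ _ _ M); first exact: (cmeasurable_trig_poly ttau).1.
  by move=> g; rewrite (le_trans (normr_Re_le _)).
under eq_integral do rewrite raddfD/= EFinD.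
rewrite integralD//; first by rewrite f0 haar_integral_character ?adde0//; exact: sep.
  exact: iRe.
exact/iRe/trig_poly_mono.
Qed.

End orthogonality.

(** * Approximation in mean by an algebra of bounded functions *)

Section Lp_approximation.
Import HBNNSimple.
Context d (T : measurableType d) (R : realType).
Variables (mu : {finite_measure set T -> \bar R}) (p : R).
Hypothesis p1 : 1 <= p.
Implicit Types f g h : T -> R.

(** The p-th power of the L^p distance. *)
Definition Lp_dist f g : \bar R := (\int[mu]_x (`|f x - g x| `^ p)%:E)%E.

Lemma Lp_dist_measurable f g : measurable_fun [set: T] f ->
  measurable_fun [set: T] g ->
  measurable_fun [set: T] (fun x => (`|f x - g x| `^ p)%:E).
Proof.
move=> mf mg; apply/measurable_EFinP.
apply: (@measurableT_comp _ _ _ _ _ _ (fun y => y `^ p)).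
  exact: measurable_powR.
by apply: measurableT_comp => //; exact: measurable_funB.
Qed.

Lemma Lp_dist_id f : Lp_dist f f = 0%E.
Proof.
rewrite /Lp_dist; apply: integral0_eq => x _.
by rewrite subrr normr0 powR0// gt_eqF// (lt_le_trans _ p1).
Qed.

Lemma Lp_dist_triangle (c : R) f g h : 0 < c < 1 -> measurable_fun [set: T] f ->
  measurable_fun [set: T] g -> measurable_fun [set: T] h ->
  (Lp_dist f h <= ((1 - c) `^ (1 - p))%:E * Lp_dist f g +
                  (c `^ (1 - p))%:E * Lp_dist g h)%E.
Proof.
move=> c01 mf mg mh; rewrite /Lp_dist.
have mfg := Lp_dist_measurable mf mg; have mgh := Lp_dist_measurable mg mh.
have mM (k : R) (F : T -> \bar R) : measurable_fun [set: T] F ->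
    measurable_fun [set: T] (fun x => k%:E * F x)%E.
  by move=> mF; exact: emeasurable_funM.
rewrite -!ge0_integralZl_EFin ?powR_ge0//.
rewrite -ge0_integralD//; first last.
- exact: mM.
- by move=> x _; rewrite mule_ge0// lee_fin powR_ge0.
- exact: mM.
- by move=> x _; rewrite mule_ge0// lee_fin powR_ge0.
apply: ge0_le_integral => //; first exact: Lp_dist_measurable.
  by apply: emeasurable_funD; exact: mM.
move=> x _; rewrite -!EFinM -EFinD lee_fin.
have p0 : 0 <= p by rewrite (le_trans _ p1).
apply: le_trans (powRD_le p1 c01 (normr_ge0 (f x - g x)) (normr_ge0 (g x - h x))).
apply: ge0_ler_powR; rewrite ?nnegrE ?addr_ge0//.
by rewrite -(subrKA (g x)) ler_normD.
Qed.

Variable alg : (T -> R) -> Prop.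
Hypothesis alg_cst : forall c, alg (fun=> c).
Hypothesis algD : forall f g, alg f -> alg g -> alg (fun x => f x + g x).
Hypothesis algM : forall f g, alg f -> alg g -> alg (fun x => f x * g x).
Hypothesis alg_bounded : forall f, alg f -> exists M : R, forall x, `|f x| <= M.
Hypothesis alg_measurable : forall f, alg f -> measurable_fun [set: T] f.

(** Boundedness is part of the notion: it makes the approximable functions an
    algebra, and gives dominated convergence for their bounded pointwise limits. *)
Definition Lp_approx f := [/\ measurable_fun [set: T] f,
  exists M : R, forall x, `|f x| <= M &
  forall e : R, 0 < e -> exists2 P, alg P & (Lp_dist f P <= e%:E)%E].

Lemma Lp_approx_alg f : alg f -> Lp_approx f.
Proof.
move=> af; split; [exact: alg_measurable|exact: alg_bounded|].
by move=> e e0; exists f => //; rewrite Lp_dist_id lee_fin ltW.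
Qed.

(** Approximating in two steps: this reduces the stability results to the case
    where one of the two functions belongs to the algebra. *)
Lemma Lp_approx_closed f : measurable_fun [set: T] f ->
  (exists M : R, forall x, `|f x| <= M) ->
  (forall e : R, 0 < e -> exists2 h, Lp_approx h & (Lp_dist f h <= e%:E)%E) ->
  Lp_approx f.
Proof.
move=> mf bf fh; split => // e e0.
set K := 2^-1 `^ (1 - p); have K0 : 0 < K by rewrite powR_gt0// invr_gt0.
have half : 0 < (2^-1 : R) < 1 by apply/andP; split; lra.
have d0 : 0 < e / (2 * K) by rewrite divr_gt0// mulr_gt0.
have [h [mh bh hP] fhd] := fh _ d0; have [P aP hPd] := hP _ d0.
exists P => //; apply: le_trans (Lp_dist_triangle half mf mh (alg_measurable aP)) _.
rewrite [X in X `^ _](_ : 1 - 2^-1 = 2^-1 :> R); last by lra.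
rewrite -/K -[leRHS](_ : K%:E * (e / (2 * K))%:E + K%:E * (e / (2 * K))%:E = e%:E)%E.
  have K0' : (0 <= K%:E)%E by rewrite lee_fin ltW.
  exact: leeD (lee_wpmul2l K0' fhd) (lee_wpmul2l K0' hPd).
by rewrite -!EFinM -EFinD; congr EFin; field; rewrite gt_eqF.
Qed.

Lemma Lp_approxDalg f P : Lp_approx f -> alg P -> Lp_approx (fun x => f x + P x).
Proof.
move=> [mf [M fM] fP] aP; have [N PN] := alg_bounded aP.
split; first exact/measurable_funD/alg_measurable.
  by exists (M + N) => x; rewrite (le_trans (ler_normD _ _))// lerD.
move=> e e0; have [Q aQ fQ] := fP e e0; exists (fun x => Q x + P x); first exact: algD.
suff -> : Lp_dist (fun x => f x + P x) (fun x => Q x + P x) = Lp_dist f Q by [].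
by rewrite /Lp_dist; apply: eq_integral => x _; congr ((`|_| `^ p)%:E); ring.
Qed.

Lemma Lp_approxD f g : Lp_approx f -> Lp_approx g -> Lp_approx (fun x => f x + g x).
Proof.
move=> af [mg [N gN] gP]; have [mf [M fM] _] := af.
apply: Lp_approx_closed; first exact: measurable_funD.
  by exists (M + N) => x; rewrite (le_trans (ler_normD _ _))// lerD.
move=> e e0; have [Q aQ gQ] := gP e e0; exists (fun x => f x + Q x).
  exact: Lp_approxDalg.
suff -> : Lp_dist (fun x => f x + g x) (fun x => f x + Q x) = Lp_dist g Q by [].
by rewrite /Lp_dist; apply: eq_integral => x _; congr ((`|_| `^ p)%:E); ring.
Qed.

Lemma Lp_dist_mul f g h (M : R) : measurable_fun [set: T] f ->
  measurable_fun [set: T] g -> measurable_fun [set: T] h ->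
  (forall x, `|h x| <= M) ->
  (Lp_dist (fun x => f x * h x)%R (fun x => g x * h x)%R <= (M `^ p)%:E * Lp_dist f g)%E.
Proof.
move=> mf mg mh hM; rewrite /Lp_dist -ge0_integralZl_EFin ?powR_ge0//;
  [|exact: Lp_dist_measurable].
have p0 : 0 <= p by rewrite (le_trans _ p1).
apply: ge0_le_integral => //.
- by apply: Lp_dist_measurable; exact: measurable_funM.
- by apply: emeasurable_funM => //; exact: Lp_dist_measurable.
- move=> x _; rewrite -EFinM lee_fin -mulrBl normrM powRM// mulrC.
  rewrite ler_wpM2r ?powR_ge0// ge0_ler_powR// nnegrE//.
  exact: le_trans (hM x).
Qed.

Lemma Lp_approxMalg f P : Lp_approx f -> alg P -> Lp_approx (fun x => f x * P x).
Proof.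
move=> [mf [M fM] fP] aP; have [N PN] := alg_bounded aP; have mP := alg_measurable aP.
split; first exact: measurable_funM.
  by exists (M * N) => x; rewrite normrM ler_pM.
move=> e e0; have N0 : 0 < N `^ p + 1 by rewrite ltr_wpDl// powR_ge0.
have [Q aQ fQ] := fP (e / (N `^ p + 1)) (divr_gt0 e0 N0).
exists (fun x => Q x * P x); first exact: algM.
apply: le_trans (Lp_dist_mul mf (alg_measurable aQ) mP PN) _.
apply: (@le_trans _ _ ((N `^ p)%:E * (e / (N `^ p + 1))%:E)%E).
  by rewrite lee_wpmul2l// lee_fin powR_ge0.
by rewrite -EFinM lee_fin mulrCA ger_pMr// ler_pdivrMr// mul1r lerDl.
Qed.

Lemma Lp_approxM f g : Lp_approx f -> Lp_approx g -> Lp_approx (fun x => f x * g x).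
Proof.
move=> af [mg [N gN] gP]; have [mf [M fM] _] := af.
apply: Lp_approx_closed; first exact: measurable_funM.
  by exists (M * N) => x; rewrite normrM ler_pM.
move=> e e0; have M0 : 0 < M `^ p + 1 by rewrite ltr_wpDl// powR_ge0.
have [Q aQ gQ] := gP (e / (M `^ p + 1)) (divr_gt0 e0 M0).
exists (fun x => f x * Q x); first exact: Lp_approxMalg.
have -> : (fun x => f x * g x) = (fun x => g x * f x).
  by apply/funext => x; rewrite mulrC.
have -> : (fun x => f x * Q x) = (fun x => Q x * f x).
  by apply/funext => x; rewrite mulrC.
apply: le_trans (Lp_dist_mul mg (alg_measurable aQ) mf fM) _.
apply: (@le_trans _ _ ((M `^ p)%:E * (e / (M `^ p + 1))%:E)%E).
  by rewrite lee_wpmul2l// lee_fin powR_ge0.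
by rewrite -EFinM lee_fin mulrCA ger_pMr// ler_pdivrMr// mul1r lerDl.
Qed.

Lemma Lp_approx_cst c : Lp_approx (fun=> c).
Proof. exact: Lp_approx_alg. Qed.

Lemma Lp_approxX f n : Lp_approx f -> Lp_approx (fun x => f x ^+ n).
Proof.
move=> af; elim: n => [|n IHn]; first exact: Lp_approx_cst.
under eq_fun do rewrite exprS; exact: (@Lp_approxM f (fun x => f x ^+ n)).
Qed.

Lemma Lp_approx_sum (I : eqType) (s : seq I) (F : I -> T -> R) :
  (forall i, i \in s -> Lp_approx (F i)) -> Lp_approx (fun x => \sum_(i <- s) F i x).
Proof.
elim: s => [|i s IHs] aF.
  by under eq_fun do rewrite big_nil; exact: Lp_approx_cst.
under eq_fun do rewrite big_cons; apply: Lp_approxD.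
  by apply: aF; rewrite mem_head.
by apply: IHs => j js; apply: aF; rewrite in_cons js orbT.
Qed.

Lemma Lp_approx_cvg (f_ : nat -> T -> R) f (M : R) :
  (forall n, Lp_approx (f_ n)) -> (forall n x, `|f_ n x| <= M) ->
  (forall x, f_ n x @[n --> \oo] --> f x) -> Lp_approx f.
Proof.
move=> af fM cvf.
have p0 : 0 < p by rewrite (lt_le_trans _ p1).
have mf_ n : measurable_fun [set: T] (f_ n) by case: (af n).
have mf : measurable_fun [set: T] f.
  by apply: (measurable_fun_cvg mf_) => x _; exact: cvf.
have fMx x : `|f x| <= M.
  have cvn : `|f_ n x| @[n --> \oo] --> `|f x| by exact: cvg_norm (cvf x).
  rewrite -(cvg_lim (@Rhausdorff R) cvn); apply: limr_le; first exact: cvgP cvn.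
  exact: nearW.
apply: Lp_approx_closed => //; first by exists M.
move=> e e0.
have : (Lp_dist f (f_ n) @[n --> \oo] --> 0)%E.
  have := @dominated_convergence _ T R mu [set: T] measurableT
    (fun n x => (`|f x - f_ n x| `^ p)%:E) (cst 0%E)
    (cst (((M + M) `^ p)%:E)).
  case => //.
  - by move=> n; exact: Lp_dist_measurable.
  - apply: aeW => x _; apply/cvg_EFin; first exact: nearW.
    apply: (cvg_powR0 p0) => // /=.
    rewrite -[X in _ --> X](normr0 R) -(subrr (f x)); apply: cvg_norm.
    by apply: cvgB => //; exact: cvg_cst.
  - by apply: finite_measure_integrable_cst.
  - apply: aeW => x n _ /=; rewrite lee_fin ger0_norm ?powR_ge0//.
    have fn : `|f x - f_ n x| <= M + M by rewrite (le_trans (ler_normB _ _))// lerD.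
    by rewrite ge0_ler_powR ?nnegrE ?(ltW p0)// (le_trans _ fn).
  - by move=> _ _; rewrite integral0.
move=> /fine_cvgP[finD /cvgrPdist_le/(_ e e0) Dle].
have [n [finn len]] : exists n, Lp_dist f (f_ n) \is a fin_num /\
    `|0 - fine (Lp_dist f (f_ n))| <= e.
  by near \oo => n; exists n; split; near: n.
exists (f_ n) => //; rewrite -(fineK finn) lee_fin.
by rewrite (le_trans _ len)// sub0r normrN ler_norm.
Unshelve. all: by end_near.
Qed.

(** A nonnegative approximable g is inverted through the geometric series of
    ratio 1 - (1 + g) / (1 + M), where M bounds g. *)
Lemma Lp_approx_inv g : Lp_approx g -> (forall x, 0 <= g x) ->
  Lp_approx (fun x => (1 + g x)^-1).
Proof.
move=> ag g0; have [_ [M0 gM0] _] := ag.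
have [M M1 gM] : exists2 M : R, 0 < M & forall x, g x < M.
  exists (`|M0| + 1); first by rewrite ltr_wpDl.
  move=> x; rewrite (@le_lt_trans _ _ `|M0|) ?ltrDl//.
  by rewrite (le_trans (ler_norm _))// (le_trans (gM0 x))// ler_norm.
pose a := (1 + M)^-1; pose z x := a * (M - g x).
have M1' : 0 < 1 + M by rewrite ltr_wpDl.
have a0 : 0 < a by rewrite invr_gt0.
have z0 x : 0 < z x by rewrite mulr_gt0// subr_gt0.
have zE x : 1 - z x = a * (1 + g x) by rewrite /z /a; field; rewrite gt_eqF.
have z1 x : `|z x| < 1.
  by rewrite gtr0_norm// -subr_gt0 zE mulr_gt0// ltr_wpDr.
have az : Lp_approx z.
  rewrite [X in Lp_approx X](_ : _ = (fun x => a * M + - a * g x)).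
    apply: (@Lp_approxD (fun=> a * M) (fun x => - a * g x)).
      exact: Lp_approx_cst.
    exact: (Lp_approxM (Lp_approx_cst (- a)) ag).
  by apply/funext => x; rewrite /z; ring.
have azE x : a / (1 - z x) = (1 + g x)^-1.
  by rewrite zE; field; rewrite !gt_eqF// ltr_wpDr.
apply: (@Lp_approx_cvg (fun n x => series (geometric a (z x)) n) _ 1).
- move=> n; apply: (@Lp_approx_sum _ (index_iota 0 n) (fun i x => a * z x ^+ i)).
  move=> i _; apply: (@Lp_approxM (fun=> a) (fun x => z x ^+ i)).
    exact: Lp_approx_cst.
  exact: Lp_approxX.
- move=> n x; rewrite ger0_norm; last first.
    by rewrite /series/=; apply: sumr_ge0 => i _; rewrite mulr_ge0// ?exprn_ge0 ?ltW.
  rewrite (le_trans (geometric_le_lim n (ltW a0) (z0 x) (z1 x)))// azE.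
  by rewrite invf_le1 ?lerDl// ltr_wpDr.
- by move=> x; rewrite -azE; exact: cvg_geometric_series.
Qed.

(** The functions 1 / (1 + (F / c) ^+ n) converge to a function H with values 1,
    1/2 and 0 where F is smaller than, equal to and greater than c; the polynomial
    2 H ^+ 2 - H then corrects the value 1/2 to 0. *)
Lemma Lp_approx_indic_lt F c : Lp_approx F -> (forall x, 0 <= F x) -> 0 < c ->
  Lp_approx \1_[set x | F x < c].
Proof.
move=> aF F0 c0.
pose H x : R := if F x / c < 1 then 1 else if F x / c == 1 then 2^-1 else 0.
have Fc0 x : 0 <= F x / c by rewrite divr_ge0// ltW.
have aH : Lp_approx H.
  apply: (@Lp_approx_cvg (fun n x => (1 + (F x / c) ^+ n)^-1) _ 1).
  - move=> n; apply: Lp_approx_inv; last by move=> x; rewrite exprn_ge0.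
    apply: Lp_approxX; exact: (Lp_approxM aF (Lp_approx_cst c^-1)).
  - move=> n x; have F1 : 0 <= (F x / c) ^+ n by rewrite exprn_ge0.
    rewrite ger0_norm ?invr_ge0 ?addr_ge0//.
    by rewrite invf_le1 ?lerDl// ltr_wpDr.
  - by move=> x; exact: cvg_inv1DX.
rewrite [X in Lp_approx X](_ : _ = (fun x => 2 * (H x * H x) + (- 1) * H x)).
  apply: (@Lp_approxD (fun x => 2 * (H x * H x)) (fun x => - 1 * H x)).
    apply: (@Lp_approxM (fun=> 2) (fun x => H x * H x)); first exact: Lp_approx_cst.
    exact: Lp_approxM.
  exact: (Lp_approxM (Lp_approx_cst (- 1)) aH).
apply/funext => x; rewrite indicE /H ltr_pdivrMr// mul1r.
have [Fc|cF] := ltP (F x) c; first by rewrite mem_set//=; ring.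
rewrite memNset//=; last by apply/negP; rewrite -leNgt.
by case: ifP => _; field.
Qed.

Definition Lp_approx_set := [set A : set T | measurable A /\ Lp_approx \1_A].

Lemma Lp_approx_setC A : Lp_approx_set A -> Lp_approx_set (~` A).
Proof.
move=> [mA aA]; split; first exact: measurableC.
rewrite [X in Lp_approx X](_ : _ = (fun x => 1 + (- 1) * \1_A x)).
  apply: (@Lp_approxD (fun=> 1) (fun x => - 1 * \1_A x)); first exact: Lp_approx_cst.
  exact: (Lp_approxM (Lp_approx_cst (- 1)) aA).
apply/funext => x; rewrite !indicE in_setC.
by case: (x \in A) => /=; ring.
Qed.

Lemma Lp_approx_setI A B : Lp_approx_set A -> Lp_approx_set B ->
  Lp_approx_set (A `&` B).
Proof.
move=> [mA aA] [mB aB]; split; first exact: measurableI.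
by rewrite indicI; exact: Lp_approxM.
Qed.

Lemma Lp_approx_setU A B : Lp_approx_set A -> Lp_approx_set B ->
  Lp_approx_set (A `|` B).
Proof.
move=> aA aB; rewrite -[A `|` B]setCK setCU.
by apply/Lp_approx_setC/Lp_approx_setI; exact: Lp_approx_setC.
Qed.

Lemma Lp_approx_set0 : Lp_approx_set set0.
Proof. by split => //; rewrite indic0; exact: Lp_approx_cst. Qed.

(** A countable union is the pointwise limit of finite unions. *)
Lemma Lp_approx_set_sigma_algebra : sigma_algebra [set: T] Lp_approx_set.
Proof.
split; first exact: Lp_approx_set0.
  by move=> A aA; rewrite setTD; exact: Lp_approx_setC.
move=> A aA; pose B n := \big[setU/set0]_(i < n) A i.
have aB n : Lp_approx_set (B n).
  rewrite /B; elim: n => [|n IHn]; first by rewrite big_ord0; exact: Lp_approx_set0.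
  by rewrite big_ord_recr; exact: (Lp_approx_setU IHn (aA n)).
split; first by apply: bigcupT_measurable => k; case: (aA k).
apply: (@Lp_approx_cvg (fun n => \1_(B n)) _ 1).
- by move=> n; case: (aB n).
- by move=> n x; rewrite indicE; case: (x \in B n); rewrite ?normr1 ?normr0.
- move=> x; rewrite indicE; case: (boolP (x \in _)) => [/set_mem[k _ Akx]|/negP nx].
    apply: (@cvg_trans _ (cst 1%:R @ \oo)); last exact: cvg_cst.
    apply: near_eq_cvg; exists k.+1 => // n /= kn.
    rewrite indicE mem_set// /B -bigcup_mkord; exists k => //=.
  apply: (@cvg_trans _ (cst 0%:R @ \oo)); last exact: cvg_cst.
  apply: near_eq_cvg; apply: nearW => n; rewrite indicE memNset//.
  rewrite /B -bigcup_mkord => -[k _ Akx]; apply: nx; apply/mem_set.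
  by exists k.
Qed.

Lemma Lp_approx_bounded_measurable f :
  (forall A, measurable A -> Lp_approx \1_A) ->
  measurable_fun [set: T] f -> (exists M : R, forall x, `|f x| <= M) -> Lp_approx f.
Proof.
move=> aA mf [M fM].
suff aff g : measurable_fun [set: T] g -> (forall x, 0 <= g x <= M + M) -> Lp_approx g.
  rewrite [X in Lp_approx X](_ : _ = (fun x => (f x + M) + - M)).
    apply: (@Lp_approxD (fun x => f x + M) (fun=> - M)); last exact: Lp_approx_cst.
    apply: aff; first exact: measurable_funD.
    by move=> x; have := fM x; rewrite ler_norml; lra.
  by apply/funext => x; rewrite addrK.
move=> mg g0M; have mg' : measurable_fun [set: T] (EFin \o g).
  exact/measurable_EFinP.
have g0 x : 0 <= g x by have /andP[] := g0M x.
pose s := nnsfun_approx measurableT mg'.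
have sg x : s n x @[n --> \oo] --> g x.
  have : (s n x)%:E @[n --> \oo] --> (g x)%:E.
    by apply: (@cvg_nnsfun_approx _ _ _ _ measurableT _ mg') => // y _; rewrite lee_fin.
  by move=> /fine_cvgP[_].
have sM n x : s n x <= M + M.
  have /andP[_] := g0M x; apply: le_trans.
  rewrite -(cvg_lim (@Rhausdorff R) (sg x)).
  apply: nondecreasing_cvgn_le; last exact: cvgP (sg x).
  by move=> i j ij; have /lefP := nd_nnsfun_approx measurableT mg' ij; exact.
apply: (@Lp_approx_cvg (fun n => s n) _ (M + M)) => //; last first.
  by move=> n x; rewrite ger0_norm.
move=> n; rewrite [X in Lp_approx X](_ : _ = (fun x =>
    \sum_(y <- fset_set (range (s n))) (y * \1_(s n @^-1` [set y]) x))).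
  apply: (@Lp_approx_sum _ _ (fun y x => y * \1_(s n @^-1` [set y]) x)) => y _.
  apply: (@Lp_approxM (fun=> y) \1_(s n @^-1` [set y])); first exact: Lp_approx_cst.
  by apply: aA; rewrite -[X in measurable X]setTI; exact: measurable_funP.
by apply/funext => x; rewrite fimfunE fsbig_finite.
Qed.

End Lp_approximation.

(** * Density of the trigonometric polynomials *)

Section dual_neighbourhoods.
Context {R : realType} {G : zmodType}.
Local Notation Gamma := (dual R G).

Lemma near_trig_poly (S : set G) (tau : Gamma -> R[i]) (g : Gamma) : trig_poly S tau ->
  forall e : R, 0 < e ->
    nbhs g [set h : Gamma | Normc.normc (tau h - tau g) < e].
Proof.
move: tau; apply: trig_poly_ind => [e e0|f a x tf nf _ e e0].
  apply: (@near_dualS _ _ g 0 e) => // h _ /=.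
  by rewrite [X in X < _](_ : _ = 0)//; exact: (normc_distrr (0 : R[i])).
have e20 : 0 < e / 2 by rewrite divr_gt0.
have a1 : 0 < Normc.normc a + 1 by rewrite ltr_wpDl// normc_ge0.
have nx := near_dual g x (divr_gt0 e20 a1).
apply: (@filterS2 _ (nbhs g) _ _ _ _ _ (nf _ e20) nx) => h /= fh xh.
have -> : f h + a * h x - (f g + a * g x) = (f h - f g) + a * (h x - g x) by ring.
rewrite (le_lt_trans (ler_normcD _ _))// [ltRHS]splitr ltr_leD//.
rewrite Normc.normcM (@le_trans _ _ (Normc.normc a * (e / 2 / (Normc.normc a + 1))))//.
  by rewrite ler_wpM2l ?normc_ge0// ltW.
by rewrite mulrCA ger_pMr// ler_pdivrMr// mul1r lerDl.
Qed.

(** As sums of nonnegative real trigonometric polynomials vanishing at g are of the same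
    kind, their sublevel sets generate a filter. It converges to g, because the square
    of |h x - g x| is such a polynomial in h, for every x. *)
Lemma nbhs_real_trig_poly (g : Gamma) (U : set Gamma) : nbhs g U ->
  exists (F : Gamma -> R) (c : R), [/\ real_trig_poly F, forall h, 0 <= F h,
    F g = 0, 0 < c & [set h | F h < c] `<=` U].
Proof.
pose B (V : set Gamma) := exists (F : Gamma -> R) (c : R), [/\ real_trig_poly F,
  forall h, 0 <= F h, F g = 0, 0 < c & [set h | F h < c] `<=` V].
have FB : Filter B.
  split.
  - by exists (fun=> 0), 1; split => //; exact: real_trig_poly_cst.
  - move=> V W [F [c [tF F0 Fg c0 FV]]] [E [d [tE E0 Eg d0 EW]]].
    exists (fun h => F h + E h), (Num.min c d); split.
    + exact: real_trig_polyD.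
    + by move=> h; rewrite addr_ge0.
    + by rewrite Fg Eg addr0.
    + by rewrite lt_min c0.
    + move=> h /=; rewrite lt_min => /andP[Fc Ed]; split.
        by apply: FV => /=; rewrite (le_lt_trans _ Fc)// lerDl.
      by apply: EW => /=; rewrite (le_lt_trans _ Ed)// lerDr.
  - move=> V W VW [F [c [tF F0 Fg c0 FV]]]; exists F, c; split => //.
    exact: subset_trans VW.
move: U; suff : (B : set_system Gamma) --> g by [].
apply: cvg_dual => x e e0.
have FE (h : Gamma) : 2 + complex.Re ((- 2 * (g x)^*%C) * h x) =
    Normc.normc (h x - g x) ^+ 2.
  have hx := dual_normc h x; have gx := dual_normc g x.
  rewrite normcE sqr_sqrtr ?addr_ge0 ?sqr_ge0//.
  have : Normc.normc (h x) ^+ 2 = 1 by rewrite hx expr1n.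
  have : Normc.normc (g x) ^+ 2 = 1 by rewrite gx expr1n.
  rewrite !normcE !sqr_sqrtr ?addr_ge0 ?sqr_ge0//.
  case: (h x) (g x) => [h1 h2] [g1 g2] /=; nra.
exists (fun h => 2 + complex.Re ((- 2 * (g x)^*%C) * h x)), (e ^+ 2); split.
- apply: real_trig_polyD; first exact: real_trig_poly_cst.
  exact: real_trig_poly_Re.
- by move=> h; rewrite FE sqr_ge0.
- by rewrite FE normc_distrr expr0n.
- by rewrite exprn_gt0.
- by move=> h /=; rewrite FE ltr_pXn2r// nnegrE ?normc_ge0// ltW.
Qed.

End dual_neighbourhoods.

Section density_of_trigonometric_polynomials.
Context {R : realType} {G : zmodType}.
Local Notation Gamma := (dual R G).

(** Stated for open sets and with a small remainder, inner regularity passes to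
    sums of measures. *)
Definition inner_regular_open (mu : {finite_measure set Gamma -> \bar R}) :=
  forall U : set Gamma, open U -> forall e : R, 0 < e ->
    exists K, [/\ compact K, K `<=` U & (mu (U `\` K) <= e%:E)%E].

Lemma regular_inner_open (mu : {finite_measure set Gamma -> \bar R}) :
  regular_measure mu -> inner_regular_open mu.
Proof.
move=> reg U oU e e0; have mU := dual_open_measurable oU.
have [muU _] := reg U mU.
have fU : mu U \is a fin_num by exact: fin_num_measure.
have supfin : ereal_sup [set mu K | K in [set K | compact K /\ K `<=` U]] \is a fin_num.
  by rewrite -muU.
have [_ [K [cK KU] <-] UK] := ub_ereal_sup_adherent e0 supfin.
exists K; split => //.
have mK := dual_compact_measurable cK.
rewrite measureD// ?setIidr//; last by rewrite -ge0_fin_numE.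
rewrite leeBlDr ?fin_num_measure//.
by move: UK; rewrite -muU lteBlDr// => /ltW; rewrite addeC.
Qed.

Lemma inner_regular_openD (mu nu : {finite_measure set Gamma -> \bar R}) :
  inner_regular_open mu -> inner_regular_open nu ->
  inner_regular_open (fin_measure_add mu nu).
Proof.
move=> rmu rnu U oU e e0; have e20 : 0 < e / 2 by rewrite divr_gt0.
have [K [cK KU muK]] := rmu U oU _ e20; have [L [cL LU nuL]] := rnu U oU _ e20.
have mU := dual_open_measurable oU.
have mK := dual_compact_measurable cK; have mL := dual_compact_measurable cL.
exists (K `|` L); split; first exact: compactU.
  by move=> x [/KU|/LU].
rewrite [X in (X <= _)%E](fin_measure_addE mu nu (U `\` (K `|` L))).
rewrite [e]splitr EFinD; apply: leeD.
- apply: le_trans muK; apply: le_measure; rewrite ?inE; last exact: setDS.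
    by apply: measurableD => //; exact: measurableU.
  exact: measurableD.
- apply: le_trans nuL; apply: le_measure; rewrite ?inE; last exact: setDS.
    by apply: measurableD => //; exact: measurableU.
  exact: measurableD.
Qed.

Variables (si : {finite_measure set Gamma -> \bar R}) (p : R).
Hypothesis p1 : 1 <= p.
Hypothesis reg : inner_regular_open si.
Let approx := @Lp_approx _ Gamma R si p real_trig_poly.
Let approx_set := @Lp_approx_set _ Gamma R si p real_trig_poly.

Let alg_bounded := @real_trig_poly_bounded R G.
Let alg_measurable := @real_trig_poly_measurable R G.

Let approx_sigma_algebra : sigma_algebra [set: Gamma] approx_set.
Proof.
apply: Lp_approx_set_sigma_algebra => //.
- exact: real_trig_poly_cst.
- exact: real_trig_polyD.
- exact: real_trig_polyM.
Qed.

Let approx_setU A B : approx_set A -> approx_set B -> approx_set (A `|` B).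
Proof.
apply: Lp_approx_setU => //.
- exact: real_trig_poly_cst.
- exact: real_trig_polyD.
- exact: real_trig_polyM.
Qed.

Let approx_lt (F : Gamma -> R) (c : R) : real_trig_poly F ->
  (forall g, 0 <= F g) -> 0 < c -> approx_set [set g | F g < c].
Proof.
move=> tF F0 c0; have mF := real_trig_poly_measurable tF; split.
  have mlt : measurable_fun [set: Gamma] (fun g => F g < c).
    exact: measurable_fun_ltr.
  by rewrite -[X in measurable X]setTI; exact: (mlt measurableT [set true]).
apply: Lp_approx_indic_lt => //.
- exact: real_trig_poly_cst.
- exact: real_trig_polyD.
- exact: real_trig_polyM.
- exact: Lp_approx_alg.
Qed.

(** Sublevel sets only generate the cylinder sets, whose sigma-algebra is smaller
    than the Borel one when G is uncountable; inner regularity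
    squeezes a finite union of sublevel sets between a compact set and U. *)
Let approx_open (U : set Gamma) : open U -> approx_set U.
Proof.
move=> oU; have mU := dual_open_measurable oU; split => //.
apply: Lp_approx_closed => //.
  by exists 1 => x; rewrite indicE; case: (x \in U); rewrite ?normr1 ?normr0.
move=> e e0; have [K [cK KU siK]] := reg oU e0.
have /choice[V VP] : forall g : Gamma, exists V : set Gamma,
    U g -> [/\ approx_set V, nbhs g V & V `<=` U].
  move=> g; have [Ug|nUg] := pselect (U g); last by exists set0.
  have nU : nbhs g U by exact: open_nbhs_nbhs.
  have [F [c [tF F0 Fg c0 FU]]] := nbhs_real_trig_poly nU.
  exists [set h | F h < c] => _; split => //; first exact: approx_lt.
  apply: filterS (near_trig_poly g tF c0) => h /=.
  apply: le_lt_trans; rewrite Fg.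
  by rewrite !subr0 expr0n addr0 sqrtr_sqr ler_norm.
have cov : cover_compact K by rewrite -compact_cover.
have [D DK KD] : finite_subset_cover K (fun g => (V g)^° ) K.
  apply: cov => [g _|g Kg]; first exact: open_interior.
  by exists g => //; have [_ nV _] := VP g (KU _ Kg).
pose W := \bigcup_(g in [set` D]) V g.
have aW : approx_set W.
  rewrite /W bigcup_fset big_seq.
  elim/big_ind : _ => [|A B aA aB|g gD]; first by case: approx_sigma_algebra.
    exact: approx_setU.
  have Kg : K g by apply/set_mem/DK.
  by have [] := VP g (KU _ Kg).
have KW : K `<=` W.
  by move=> h /KD[g gD hV]; exists g => //; exact: interior_subset hV.
have WU : W `<=` U.
  move=> h [g gD]; have Kg : K g by apply/set_mem/DK.
  by have [_ _] := VP g (KU _ Kg); exact.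
exists \1_W; first by case: aW.
have [mW _] := aW; have mK := dual_compact_measurable cK.
have mUK : measurable (U `\` K) by exact: measurableD.
apply: le_trans siK; rewrite -[U `\` K]setIT -integral_indic//.
apply: ge0_le_integral => //.
- by apply: Lp_dist_measurable; exact: measurable_indic.
- by apply/measurable_EFinP; exact: measurable_indic.
- move=> h _; rewrite lee_fin !indicE.
  have p0 : p != 0 by rewrite gt_eqF// (lt_le_trans _ p1).
  have [Uh|nUh] := pselect (U h); last first.
    have nWh : ~ W h by move=> Wh; exact/nUh/WU.
    have nUKh : ~ (U `\` K) h by case.
    by rewrite (memNset nUh) (memNset nWh) (memNset nUKh) subrr normr0 powR0.
  rewrite (mem_set Uh); have [Wh|nWh] := pselect (W h).
    by rewrite (mem_set Wh) subrr normr0 powR0.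
  rewrite (memNset nWh) subr0 normr1 powR1 mem_set//; split => // Kh.
  exact/nWh/KW.
Qed.

Lemma real_trig_poly_dense (f : Gamma -> R) : measurable_fun [set: Gamma] f ->
  (exists M : R, forall x, `|f x| <= M) ->
  forall e : R, 0 < e -> exists2 P, real_trig_poly P & (Lp_dist si p f P <= e%:E)%E.
Proof.
move=> mf bf; suff [] : approx f by [].
apply: Lp_approx_bounded_measurable => //.
- exact: real_trig_poly_cst.
- exact: real_trig_polyD.
- exact: real_trig_polyM.
move=> A mA; suff [] : approx_set A by [].
exact: (smallest_sub approx_sigma_algebra (fun U oU => approx_open oU) mA).
Qed.

End density_of_trigonometric_polynomials.

(** * Negative powers of a weight *)

Section negative_powers.
Context {R : realType}.
Implicit Types r p t : R.

Definition epowN r t : \bar R := if t == 0 then +oo%E else (t `^ (- r))%:E.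

Lemma epowN_pos r t : 0 < t -> epowN r t = (t `^ (- r))%:E.
Proof. by move=> t0; rewrite /epowN gt_eqF. Qed.

Lemma epowN_ge0 r t : (0 <= epowN r t)%E.
Proof. by rewrite /epowN; case: ifP => // _; rewrite lee_fin powR_ge0. Qed.

Lemma epowN_gt0 r t : 0 <= t -> (0 < epowN r t)%E.
Proof.
move=> t0; rewrite /epowN; case: ifPn => // tn0.
by rewrite lte_fin powR_gt0// lt_neqAle eq_sym tn0.
Qed.

Lemma ler_powRN r t u : 0 <= r -> 0 < t -> t <= u -> u `^ (- r) <= t `^ (- r).
Proof.
move=> r0 t0 tu; have u0 : 0 < u by exact: lt_le_trans tu.
rewrite !powRN lef_pV2 ?posrE ?powR_gt0//.
by apply: ge0_ler_powR => //; rewrite nnegrE ltW.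
Qed.

Lemma epowN_le r t u : 0 <= r -> 0 <= t -> t <= u -> (epowN r u <= epowN r t)%E.
Proof.
move=> r0; rewrite le_eqVlt => /predU1P[<- _|t0 tu].
  by rewrite [X in (_ <= X)%E]/epowN eqxx leey.
rewrite !epowN_pos//; last exact: lt_le_trans tu.
by rewrite lee_fin ler_powRN.
Qed.

Lemma epowNM r c t : 0 < c -> 0 <= t ->
  epowN r (c * t) = ((c `^ (- r))%:E * epowN r t)%E.
Proof.
move=> c0; rewrite le_eqVlt => /predU1P[<-|t0].
  by rewrite mulr0 /epowN eqxx gt0_muley// lte_fin powR_gt0.
by rewrite !epowN_pos ?mulr_gt0// powRM ?ltW// EFinM.
Qed.

Lemma cvg_epowN r (u : nat -> R) (l : R) : 0 < r -> (forall n, 0 <= u n) ->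
  u n @[n --> \oo] --> l -> epowN r (u n) @[n --> \oo] --> epowN r l.
Proof.
move=> r0 u0 cu; have l0 : 0 <= l.
  by rewrite -(cvg_lim (@Rhausdorff R) cu); apply: limr_ge; [exact: cvgP cu|exact: nearW].
move: l0; rewrite le_eqVlt => /predU1P[l0|l0].
  rewrite -l0 in cu *; rewrite {2}/epowN eqxx.
  apply/cvgeyPge => A.
  have B0 : 0 < `|A| + 1 by rewrite ltr_wpDl.
  have d0 : 0 < (`|A| + 1) `^ (- r^-1) by exact: powR_gt0.
  move/cvgrPdist_lt/(_ _ d0) : cu; apply: filterS => n.
  rewrite sub0r normrN (ger0_norm (u0 n)) => und.
  apply: (@le_trans _ _ (epowN r ((`|A| + 1) `^ (- r^-1)))); last exact/epowN_le/ltW/und/u0/ltW/r0.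
  rewrite epowN_pos// lee_fin -powRrM mulrNN mulVf ?gt_eqF// (powRr1 (ltW B0)).
  by rewrite (le_trans (ler_norm _))// lerDl.
rewrite epowN_pos//; apply: (@cvg_trans _ ((fun n => (u n `^ (- r))%:E) @ \oo)).
  apply: near_eq_cvg; near=> n; rewrite epowN_pos//.
  by near: n; exact: cvgr_gt cu _ l0.
apply/cvg_EFin; first exact: nearW.
by apply: cvg_powR.
Unshelve. all: by end_near.
Qed.

Lemma measurable_epowN d (T : measurableType d) r (w : T -> R) :
  measurable_fun [set: T] w -> measurable_fun [set: T] (fun x => epowN r (w x)).
Proof.
move=> mw; apply: measurable_fun_ifT.
- by apply: measurable_fun_eqr => //; exact: measurable_cst.
- exact: measurable_cst.
- apply/measurable_EFinP.
  by apply: (@measurableT_comp _ _ _ _ _ _ (fun y => y `^ (- r))); first exact: measurable_powR.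
Qed.

(** [kolmogorov p W] is the distance attached to the integral W of
    w `^ (- (p - 1)^-1): the power W `^ (1 - p), vanishing at W = +oo. *)
Definition kolmogorov p (W : \bar R) : R :=
  if W is x%:E then x `^ (1 - p) else 0.

Lemma kolmogorov_ge0 p W : 0 <= kolmogorov p W.
Proof. by case: W => [x||]//=; rewrite powR_ge0. Qed.

Lemma cvg_kolmogorov p (u : nat -> \bar R) (l : \bar R) : 1 < p -> (0 < l)%E ->
  u n @[n --> \oo] --> l -> kolmogorov p (u n) @[n --> \oo] --> kolmogorov p l.
Proof.
move=> p1; case: l => [l||]//=.
  rewrite lte_fin => l0 /fine_cvgP[ufin cu].
  apply: (@cvg_trans _ ((fun n => fine (u n) `^ (1 - p)) @ \oo)).
    by apply: near_eq_cvg; apply: filterS ufin => n; case: (u n).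
  exact: cvg_powR.
move=> _ /cvgeyPge cu; apply/cvgrPdist_le => e e0.
have q0 : 0 < p - 1 by rewrite subr_gt0.
have A0 : 0 < e `^ (- (p - 1)^-1) by exact: powR_gt0.
apply: filterS (cu (e `^ (- (p - 1)^-1))) => n.
rewrite sub0r normrN ger0_norm ?kolmogorov_ge0//.
case: (u n) => [x||] /=; [|by move=> _; exact: ltW|by move=> _; exact: ltW].
rewrite lee_fin => Ax; have -> : 1 - p = - (p - 1) by ring.
apply: le_trans (ler_powRN (ltW q0) A0 Ax) _.
by rewrite -powRrM mulrNN mulVf ?gt_eqF// (powRr1 (ltW e0)).
Qed.

End negative_powers.

(** * The weighted tangent inequality *)

Section weighted_tangent.
Context {R : realType}.
Implicit Types p k w t : R.

Lemma powRN_conjugate p w : 1 < p -> 0 < w ->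
  (w `^ (- (p - 1)^-1)) `^ (p - 1) * w = 1.
Proof.
move=> p1 w0; have q0 : p - 1 != 0 by rewrite subr_eq0 gt_eqF.
by rewrite -powRrM mulNr mulVf// powR_inv1 ?ltW// mulVf// gt_eqF.
Qed.

Lemma powRN_conjugateS p w : 1 < p -> 0 < w ->
  (w `^ (- (p - 1)^-1)) `^ p * w = w `^ (- (p - 1)^-1).
Proof.
move=> p1 w0; rewrite -mulr_powRB1 ?powR_gt0// -mulrA.
by rewrite powRN_conjugate// mulr1.
Qed.

(** The tangent inequality at s = k v with v = w `^ (- (p - 1)^-1), multiplied by w;
    the power of v is chosen so that v `^ (p - 1) * w = 1. *)
Lemma weighted_tangent_lt p k w t : 1 < p -> 0 < k -> 0 < w -> 0 <= t ->
  t != k * w `^ (- (p - 1)^-1) ->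
  p * k `^ (p - 1) * t < t `^ p * w + (p - 1) * k `^ p * w `^ (- (p - 1)^-1).
Proof.
move=> p1 k0 w0 t0 tn; have v0 : 0 < w `^ (- (p - 1)^-1) by exact: powR_gt0.
have := powR_tangent_lt p1 (mulr_gt0 k0 v0) t0 tn.
rewrite -(ltr_pM2r w0) !powRM ?ltW//; congr (_ < _).
  transitivity (p * k `^ (p - 1) * t * ((w `^ (- (p - 1)^-1)) `^ (p - 1) * w)).
    by ring.
  by rewrite powRN_conjugate// mulr1.
rewrite mulrDl; congr (_ + _).
transitivity ((p - 1) * k `^ p * ((w `^ (- (p - 1)^-1)) `^ p * w)); first by ring.
by rewrite powRN_conjugateS.
Qed.

Lemma weighted_tangent p k w t : 1 < p -> 0 < k -> 0 < w -> 0 <= t ->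
  p * k `^ (p - 1) * t <= t `^ p * w + (p - 1) * k `^ p * w `^ (- (p - 1)^-1).
Proof.
move=> p1 k0 w0 t0.
have [->|tn] := eqVneq t (k * w `^ (- (p - 1)^-1)); last first.
  exact/ltW/weighted_tangent_lt.
have v0 : 0 < w `^ (- (p - 1)^-1) by exact: powR_gt0.
rewrite (powRM _ (ltW k0) (ltW v0)) -[X in _ <= X + _]mulrA powRN_conjugateS// -(mulr_powRB1 p k0).
by rewrite le_eqVlt; apply/orP; left; apply/eqP; ring.
Qed.

(** At w = 0 the right-hand side is infinite. *)
Lemma weighted_tangent_epowN p k w t : 1 < p -> 0 < k -> 0 <= w -> 0 <= t ->
  ((p * k `^ (p - 1) * t)%:E <=
   (t `^ p * w)%:E + ((p - 1) * k `^ p)%:E * epowN (p - 1)^-1 w)%E.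
Proof.
move=> p1 k0; rewrite le_eqVlt => /predU1P[<-|w0] t0.
  rewrite /epowN eqxx gt0_muley ?addey ?leey//.
  by rewrite lte_fin mulr_gt0 ?powR_gt0// subr_gt0.
by rewrite epowN_pos// -EFinM -EFinD lee_fin weighted_tangent.
Qed.

End weighted_tangent.

Section weighted_Lp.
Context d (T : measurableType d) (R : realType).
Variables (mu la : {finite_measure set T -> \bar R}) (w : T -> R) (p : R).
Hypothesis p1 : 1 < p.
Hypothesis muw : has_density mu la w.

(** The integral W of Kolmogorov's formula. *)
Definition dual_weight : \bar R := (\int[la]_x epowN (p - 1)^-1 (w x))%E.

Lemma measurable_powR_abs (f : T -> R) : measurable_fun [set: T] f ->
  measurable_fun [set: T] (fun x => `|f x| `^ p).
Proof.
move=> mf; apply: (@measurableT_comp _ _ _ _ _ _ (fun y => y `^ p)).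
  exact: measurable_powR.
exact: measurableT_comp.
Qed.

(** The tangent inequality, integrated: it bounds the norm of L^1(la) by that
    of L^p(mu) whenever the dual weight is finite. *)
Lemma int_abs_le (f : T -> R) (k : R) : measurable_fun [set: T] f -> 0 < k ->
  ((p * k `^ (p - 1))%:E * \int[la]_x `|f x|%:E <=
   \int[mu]_x (`|f x| `^ p)%:E + ((p - 1) * k `^ p)%:E * dual_weight)%E.
Proof.
move=> mf k0; have mw := density_measurable muw; have w0 := density_ge0 muw.
have c0 : 0 <= (p - 1) * k `^ p.
  by rewrite mulr_ge0 ?powR_ge0// subr_ge0 ltW.
have c1 : 0 <= p * k `^ (p - 1) by rewrite mulr_ge0 ?powR_ge0// ltW// (lt_trans _ p1).
have mfp := measurable_powR_abs mf.
have me := measurable_epowN (p - 1)^-1 mw.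
have mabs : measurable_fun [set: T] (fun x => `|f x|%:E).
  by apply/measurable_EFinP; exact: measurableT_comp.
rewrite (density_int muw); last 2 first.
- by move=> x; rewrite lee_fin powR_ge0.
- exact/measurable_EFinP.
rewrite -ge0_integralZl_EFin//.
rewrite -ge0_integralZl_EFin//; last by move=> x _; exact: epowN_ge0.
rewrite -ge0_integralD//; first last.
- by apply: emeasurable_funM.
- by move=> x _; rewrite mule_ge0 ?epowN_ge0.
- by apply: emeasurable_funM; exact/measurable_EFinP.
- by move=> x _; rewrite -EFinM lee_fin mulr_ge0// powR_ge0.
apply: ge0_le_integral => //.
- by move=> x _; rewrite -EFinM lee_fin mulr_ge0.
- by apply: emeasurable_funM.
- apply: emeasurable_funD; apply: emeasurable_funM => //; exact/measurable_EFinP.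
- by move=> x _; rewrite -EFinM -EFinM; exact: weighted_tangent_epowN.
Qed.

Hypothesis finW : dual_weight \is a fin_num.

Lemma ae_density_gt0_dual : {ae la, forall x, 0 < w x}.
Proof.
have mw := density_measurable muw; have w0 := density_ge0 muw.
have ie : la.-integrable [set: T] (fun x => epowN (p - 1)^-1 (w x)).
  apply/integrableP; split; first exact: measurable_epowN.
  under eq_integral do rewrite gee0_abs ?epowN_ge0//.
  by rewrite -ge0_fin_numE// integral_ge0// => x _; exact: epowN_ge0.
apply: filterS (integrable_ae measurableT ie) => x /(_ I).
by rewrite /epowN lt_neqAle w0 andbT eq_sym; case: ifP.
Qed.

(** The bound of [int_abs_le] with k chosen so that both of its terms have
    the same order. *)
Lemma int_abs_small (f : T -> R) (k : R) : measurable_fun [set: T] f -> 0 < k ->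
  (\int[mu]_x (`|f x| `^ p)%:E <= (k `^ p)%:E)%E ->
  (\int[la]_x `|f x|%:E <= (k * ((1 + (p - 1) * fine dual_weight) / p))%:E)%E.
Proof.
move=> mf k0 fk; have p0 : 0 < p by exact: lt_trans p1.
have c0 : 0 < p * k `^ (p - 1) by rewrite mulr_gt0 ?powR_gt0.
rewrite -(@lee_pmul2l _ (p * k `^ (p - 1))%:E)// ?lte_fin//.
apply: le_trans (int_abs_le mf k0) _.
apply: le_trans (leeD2r _ fk) _.
rewrite -(fineK finW) -!EFinM -EFinD lee_fin -(mulr_powRB1 p k0).
by rewrite le_eqVlt; apply/orP; left; apply/eqP; field; rewrite gt_eqF.
Qed.

End weighted_Lp.

(** * The upper bound for the distance *)

(** The special case of the constant density 1. *)
Lemma int_abs_small_id d (T : measurableType d) (R : realType)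
    (la : {finite_measure set T -> \bar R}) (p : R) (f : T -> R) (k : R) :
  1 < p -> la [set: T] = 1%E -> measurable_fun [set: T] f -> 0 < k ->
  (\int[la]_x (`|f x| `^ p)%:E <= (k `^ p)%:E)%E ->
  (\int[la]_x `|f x|%:E <= k%:E)%E.
Proof.
move=> p1 la1 mf k0 fk.
have dens1 : has_density la la (fun=> 1).
  by split => // F F0 mF; apply: eq_integral => x _; rewrite mule1.
have W1 : dual_weight la (fun=> 1) p = 1%E.
  rewrite /dual_weight; under eq_integral do rewrite epowN_pos ?ltr01// powR1.
  by rewrite integral_cst// mul1e.
have finW : dual_weight la (fun=> 1) p \is a fin_num by rewrite W1.
have := int_abs_small p1 dens1 finW mf k0 fk.
rewrite W1 /= mulr1 [1 + _]addrC subrK divff ?mulr1//.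
by rewrite gt_eqF// (lt_trans _ p1).
Qed.

Section upper_bound.
Context {R : realType} {G : zmodType}.
Local Notation Gamma := (dual R G).
Local Notation S := [set x : G | x != 0].
Variables (lambda mu : {finite_measure set Gamma -> \bar R}) (p : R).
Hypothesis haar : normalized_haar lambda.
Hypothesis sep : forall x : G, x != 0 -> exists g : Gamma, g x != 1.
Hypothesis p1 : 1 < p.
Hypothesis reg : regular_measure mu.

(** A trigonometric polynomial P close to f both in L^p(mu) and in L^p(lambda) has
    a constant coefficient close to the lambda-mean of f, that is to 0; removing
    this coefficient does not spoil the approximation in L^p(mu). *)
Lemma mean_zero_dense (f : Gamma -> R) : measurable_fun [set: Gamma] f ->
  (exists M : R, forall x, `|f x| <= M) -> (\int[lambda]_g (f g)%:E = 0)%E ->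
  forall e : R, 0 < e -> exists2 Q : Gamma -> R,
    trig_poly S (fun g => (Q g)%:C%C) & (Lp_dist mu p f Q <= e%:E)%E.
Proof.
move=> mf [M fM] f0 e e0; have p0 : 0 < p by exact: lt_trans p1.
have lambda1 : lambda [set: Gamma] = 1%E by case: haar.
have finmu : mu [set: Gamma] \is a fin_num by exact: fin_num_measure.
set m := fine (mu [set: Gamma]).
have m0 : 0 <= m by rewrite fine_ge0.
set K := 2^-1 `^ (1 - p); have K0 : 0 < K by rewrite powR_gt0// invr_gt0.
(* P is taken within t of f; then its mean is at most k, and k `^ p = t *)
pose t := e / (K * (1 + m)).
have t0 : 0 < t by rewrite divr_gt0// mulr_gt0// ltr_wpDr.
pose k := t `^ p^-1.
have k0 : 0 < k by exact: powR_gt0.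
have kp : k `^ p = t by rewrite /k -powRrM mulVf ?gt_eqF// powRr1// ltW.
pose si := fin_measure_add mu lambda.
have regsi : inner_regular_open si.
  by apply: inner_regular_openD; apply: regular_inner_open => //; case: haar.
have [P tP fP] := real_trig_poly_dense (ltW p1) regsi mf (ex_intro _ M fM) t0.
have mP := real_trig_poly_measurable tP.
have [N PN] := real_trig_poly_bounded tP.
have mfP := Lp_dist_measurable p mf mP.
have fP0 x : [set: Gamma] x -> (0 <= (`|f x - P x| `^ p)%:E)%E.
  by move=> _; rewrite lee_fin powR_ge0.
have fPE : Lp_dist si p f P = (Lp_dist mu p f P + Lp_dist lambda p f P)%E.
  exact: (ge0_integral_measure_add mu lambda measurableT fP0 mfP).
have Dge0 (nu : {finite_measure set Gamma -> \bar R}) : (0 <= Lp_dist nu p f P)%E.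
  by apply: integral_ge0.
have fPmu : (Lp_dist mu p f P <= t%:E)%E.
  by apply: le_trans fP; rewrite fPE leeDl.
have fPla : (Lp_dist lambda p f P <= t%:E)%E.
  by apply: le_trans fP; rewrite fPE leeDr.
have [a ta] := trig_poly_split tP.
(* the constant coefficient is the mean, hence real *)
pose a0 := complex.Re a.
have iP : lambda.-integrable [set: Gamma] (EFin \o P).
  exact: bounded_integrable mP PN.
have if_ : lambda.-integrable [set: Gamma] (EFin \o f).
  exact: bounded_integrable mf fM.
have icst (c : R) : lambda.-integrable [set: Gamma] (cst c%:E).
  exact: finite_measure_integrable_cst.
have intc (c : R) : (\int[lambda]_g c%:E = c%:E)%E.
  rewrite integral_cst//; apply: etrans (mule1 _); congr (_ * _)%E; exact: lambda1.
have meanP : (\int[lambda]_g (P g)%:E = a0%:E)%E.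
  have := haar_integral_trig_poly haar sep ta.
  under eq_integral do rewrite raddfB /= EFinB.
  rewrite integralB//; last exact: icst.
  have finP := integrable_fin_num measurableT iP.
  by rewrite intc -(fineK finP) -EFinB => -[/eqP]; rewrite subr_eq0 => /eqP ->.
have Ima : complex.Im a = 0.
  have := haar_integral_trig_poly haar sep (trig_polyZ ('i%C) ta).
  have E g : complex.Re ('i%C * ((P g)%:C%C - a)) = complex.Im a.
    by case: (a) => a1 a2 /=; ring.
  under eq_integral do rewrite E.
  by rewrite intc => -[].
have a0k : `|a0| <= k.
  rewrite -lee_fin -abse_EFin -meanP.
  rewrite -[X in `|X|%E](_ : (\int[lambda]_g (P g - f g)%:E)%E = _); last first.
    by under eq_integral do rewrite EFinB; rewrite integralB// f0 sube0.
  apply: le_trans (le_abse_integral _ _ _) _ => //.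
    by apply/measurable_EFinP; exact: measurable_funB.
  apply: (int_abs_small_id p1) => //; first exact: measurable_funB.
  rewrite kp; apply: le_trans fPla; rewrite /Lp_dist.
  by under eq_integral do rewrite distrC.
exists (fun g => P g - a0).
  rewrite [X in trig_poly _ X](_ : _ = fun g => (P g)%:C%C - a)//.
  have aE : a0%:C%C = a by rewrite [RHS]complexE Ima mulr0 addr0.
  by apply/funext => g; rewrite rmorphB/= aE.
have half : 0 < (2^-1 : R) < 1 by apply/andP; split; lra.
have mPa : measurable_fun [set: Gamma] (fun g => P g - a0).
  exact: measurable_funB.
apply: le_trans (Lp_dist_triangle mu (ltW p1) half mf mP mPa) _.
rewrite [X in X `^ _](_ : 1 - 2^-1 = 2^-1 :> R); last by lra.
rewrite -/K.
have Pa0 : (Lp_dist mu p P (fun g => P g - a0)%R <= (t * m)%:E)%E.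
  rewrite /Lp_dist; under eq_integral do rewrite subKr.
  apply: (@le_trans _ _ ((`|a0| `^ p)%:E * mu [set: Gamma])%E).
    by rewrite integral_cst.
  rewrite -(fineK finmu) -EFinM lee_fin ler_wpM2r//.
  by rewrite -kp ge0_ler_powR ?nnegrE// ltW.
have K0' : (0 <= K%:E)%E by rewrite lee_fin ltW.
apply: le_trans (leeD (lee_wpmul2l K0' fPmu) (lee_wpmul2l K0' Pa0)) _.
rewrite -!EFinM -EFinD lee_fin le_eqVlt; apply/orP; left; apply/eqP.
by rewrite /t; field; rewrite !gt_eqF// ltr_wpDr.
Qed.

(** An approximation Q of 1 - f gives the competitor 1 - Q, close to f; the error
    coefficient c of the triangle inequality is sent to 0 after the error e. *)
Lemma dist_p_le (f : Gamma -> R) : measurable_fun [set: Gamma] f ->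
  (exists M : R, forall x, `|f x| <= M) -> (\int[lambda]_g (f g)%:E = 1)%E ->
  (dist_p mu p S <= \int[mu]_g (`|f g| `^ p)%:E)%E.
Proof.
move=> mf [M fM] f1; have p0 : 0 < p by exact: lt_trans p1.
have mfp := measurable_powR_abs p mf.
have lambda1 : lambda [set: Gamma] = 1%E by case: haar.
pose A := (\int[mu]_g (`|f g| `^ p)%:E)%E.
have A0 : (0 <= A)%E by apply: integral_ge0 => x _; rewrite lee_fin powR_ge0.
have finA : A \is a fin_num.
  apply: (@integrable_fin_num _ _ _ mu [set: Gamma] _ (fun x => (`|f x| `^ p)%:E)) => //.
  apply: (@bounded_integrable _ _ _ _ _ (M `^ p)) => // x.
  rewrite ger0_norm ?powR_ge0//; apply: ge0_ler_powR; rewrite ?nnegrE ?(ltW p0)//.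
  exact: le_trans (fM x).
have m1 : measurable_fun [set: Gamma] (fun=> 1 : R) by exact: measurable_cst.
have mg : measurable_fun [set: Gamma] (fun g => 1 - f g) by exact: measurable_funB.
have bg : exists N : R, forall x, `|1 - f x| <= N.
  exists (1 + M) => x; rewrite (le_trans (ler_normB _ _))// normr1 lerD2l.
  exact: fM.
have g0 : (\int[lambda]_g (1 - f g)%:E = 0)%E.
  under eq_integral do rewrite EFinB.
  rewrite integralB//.
  - by rewrite f1 integral_cst// mul1e [X in (X - _)%E]lambda1 subee.
  - exact: finite_measure_integrable_cst.
  - exact: bounded_integrable mf fM.
have dle (c e : R) : 0 < c < 1 -> 0 < e ->
    (dist_p mu p S <= ((1 - c) `^ (1 - p))%:E * A + (c `^ (1 - p))%:E * e%:E)%E.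
  move=> c01 e0; have [Q tQ gQ] := mean_zero_dense mg bg g0 e0.
  have mQ : measurable_fun [set: Gamma] Q by have [] := cmeasurable_trig_poly tQ.
  apply: (@le_trans _ _ (Lp_dist mu p (fun=> 1) Q)).
    apply: ereal_inf_lbound; exists (fun g => (Q g)%:C%C); first exact: tQ.
    apply: eq_integral => g _; rewrite (_ : _ - _ = (1 - Q g)%:C%C) ?normc_real//.
    by rewrite rmorphB.
  apply: le_trans (Lp_dist_triangle mu (ltW p1) c01 m1 mg mQ) _.
  have -> : Lp_dist mu p (fun=> 1) (fun g => 1 - f g) = A.
    by apply: eq_integral => g _; rewrite subKr.
  by rewrite leeD2l// lee_wpmul2l// lee_fin powR_ge0.
have D0 : (0 <= dist_p mu p S)%E.
  by apply: le_ereal_inf_tmp => _ [tau _ <-]; apply: integral_ge0 => g _; rewrite lee_fin powR_ge0.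
have half : 0 < (2^-1 : R) < 1 by apply/andP; split; lra.
have finD : dist_p mu p S \is a fin_num.
  rewrite ge0_fin_numE//; apply: le_lt_trans (dle _ _ half ltr01) _.
  by rewrite -(fineK finA) -!EFinM -EFinD ltry.
have dle1 c : 0 < c < 1 -> fine (dist_p mu p S) <= (1 - c) `^ (1 - p) * fine A.
  move=> c01; apply/ler_addgt0Pr => e e0.
  have [c0 _] := andP c01.
  have ec0 : 0 < e / c `^ (1 - p) by rewrite divr_gt0 ?powR_gt0.
  have := dle _ _ c01 ec0.
  rewrite -{1}(fineK finD) -{1}(fineK finA) -!EFinM -EFinD lee_fin.
  by rewrite mulrC [X in _ + X]mulrC divfK// gt_eqF ?powR_gt0.
rewrite -/A -(fineK finD) -(fineK finA) lee_fin.
have cvg1 : (1 - n.+2%:R^-1) `^ (1 - p) * fine A @[n --> \oo] --> fine A.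
  rewrite -[X in _ --> X]mul1r; apply: cvgMl.
  rewrite -[X in _ --> X](_ : 1 `^ (1 - p) = 1 :> R); last by rewrite powR1.
  apply: cvg_powR => //.
  rewrite -[X in _ --> X]subr0; apply: cvgB; first exact: cvg_cst.
  by have := @cvg_harmonic R; rewrite -cvg_shiftS.
rewrite -(cvg_lim (@Rhausdorff R) cvg1); apply: limr_ge; first exact: cvgP cvg1.
apply: nearW => n; apply: dle1.
by rewrite invr_gt0 ltr0n/= invf_lt1// ltr1n.
Qed.

End upper_bound.

Section dual_weight_limits.
Context d (T : measurableType d) (R : realType).
Variables (la : {finite_measure set T -> \bar R}) (p : R).
Hypothesis p1 : 1 < p.
Hypothesis la1 : la [set: T] = 1%E.
Let r : R := (p - 1)^-1.

Let r0 : 0 < r. Proof. by rewrite invr_gt0 subr_gt0. Qed.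

Lemma dual_weight_ge0 (w : T -> R) : (0 <= dual_weight la w p)%E.
Proof. by apply: integral_ge0 => x _; exact: epowN_ge0. Qed.

Lemma dual_weight_gt0 (w : T -> R) : measurable_fun [set: T] w ->
  (forall x, 0 <= w x) -> (0 < dual_weight la w p)%E.
Proof.
move=> mw w0; rewrite lt_neqAle dual_weight_ge0 andbT; apply/negP => /eqP W0.
have : ae_eq la [set: T] (fun x => epowN r (w x)) (cst 0%E).
  apply: (@ae_eq_integral_abs _ _ _ la _ measurableT _ _).1.
    exact: measurable_epowN.
  by under eq_integral do rewrite gee0_abs ?epowN_ge0//.
move=> [N [mN N0 NP]].
have NT : N = [set: T].
  apply/seteqP; split => // x _; apply: NP => /= /(_ I) e0.
  by have := epowN_gt0 r (w0 x); rewrite e0 ltxx.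
have /eqP : 1%E = 0%E :> \bar R.
  exact: etrans (esym la1) (etrans (congr1 la (esym NT)) N0).
by rewrite onee_eq0.
Qed.

(** Monotone convergence. *)
Lemma cvg_dual_weightDinv (w : T -> R) : measurable_fun [set: T] w ->
  (forall x, 0 <= w x) ->
  dual_weight la (fun x => w x + k.+1%:R^-1) p @[k --> \oo] --> dual_weight la w p.
Proof.
move=> mw w0; rewrite /dual_weight -/r.
have cw x : w x + k.+1%:R^-1 @[k --> \oo] --> w x.
  rewrite -[X in _ --> X]addr0; apply: cvgD; first exact: cvg_cst.
  exact: cvg_harmonic.
have u0 (k : nat) x : 0 <= w x + k.+1%:R^-1 by rewrite addr_ge0.
rewrite (@eq_integral _ _ _ la _ (fun x => limn (fun k => epowN r (w x + k.+1%:R^-1)))).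
  apply: cvg_monotone_convergence => //.
  - by move=> k; apply: measurable_epowN; exact: measurable_funD.
  - by move=> k x _; exact: epowN_ge0.
  - move=> x _ k l kl; apply: epowN_le; [exact: ltW|exact: u0|].
    by rewrite lerD2l lef_pV2 ?posrE// ler_nat ltnS.
move=> x _; apply/esym/cvg_lim => //; exact: cvg_epowN.
Qed.

End dual_weight_limits.

Section kolmogorov_formula.
Context {R : realType} {G : zmodType}.
Local Notation Gamma := (dual R G).
Local Notation S := [set x : G | x != 0].
Variables (lambda mu : {finite_measure set Gamma -> \bar R}) (p : R).
Variable w : Gamma -> R.
Hypothesis haar : normalized_haar lambda.
Hypothesis sep : forall x : G, x != 0 -> exists g : Gamma, g x != 1.
Hypothesis p1 : 1 < p.
Hypothesis reg : regular_measure mu.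
Hypothesis muw : has_density mu lambda w.

Let lambda1 : lambda [set: Gamma] = 1%E. Proof. by case: haar. Qed.
Let W := dual_weight lambda w p.
Let W0 : (0 < W)%E.
Proof.
by apply: dual_weight_gt0 => //; [exact: density_measurable muw|exact: density_ge0 muw].
Qed.

Lemma dist_p_ge0 : (0 <= dist_p mu p S)%E.
Proof.
apply: le_ereal_inf_tmp => _ [tau _ <-]; apply: integral_ge0 => g _.
by rewrite lee_fin powR_ge0.
Qed.

(** The competitors are the normalizations of (w + 1 / (k + 1)) `^ (- (p - 1)^-1),
    bounded approximations of the function that is extremal when W is finite. *)
Lemma dist_p_le_kolmogorov : (dist_p mu p S <= (kolmogorov p W)%:E)%E.
Proof.
have mw := density_measurable muw; have w0 := density_ge0 muw.
set r := (p - 1)^-1; have r0 : 0 < r by rewrite invr_gt0 subr_gt0.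
have p0 : 0 < p by exact: lt_trans p1.
pose u k g := w g + k.+1%:R^-1.
have u0 k g : 0 < u k g by rewrite ltr_wpDl.
have mu_ k : measurable_fun [set: Gamma] (u k) by exact: measurable_funD.
pose h k g := u k g `^ (- r).
have h0 k g : 0 < h k g by exact: powR_gt0.
have mh k : measurable_fun [set: Gamma] (h k).
  apply: (@measurableT_comp _ _ _ _ _ _ (fun y => y `^ (- r))); last exact: mu_.
  exact: measurable_powR.
have hM k g : `|h k g| <= k.+1%:R^-1 `^ (- r).
  rewrite gtr0_norm//; apply: ler_powRN; first exact: ltW.
    by rewrite invr_gt0.
  by rewrite lerDr.
have ih k : lambda.-integrable [set: Gamma] (EFin \o h k).
  exact: bounded_integrable (mh k) (hM k).
have JE k : dual_weight lambda (u k) p = (\int[lambda]_g (h k g)%:E)%E.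
  by apply: eq_integral => g _; rewrite epowN_pos.
have finJ k : dual_weight lambda (u k) p \is a fin_num.
  by rewrite JE; exact: (integrable_fin_num measurableT (ih k)).
have J0 k : 0 < fine (dual_weight lambda (u k) p).
  apply: fine_gt0; apply/andP; split.
    by apply: dual_weight_gt0 => // g; exact: ltW.
  by rewrite -ge0_fin_numE ?dual_weight_ge0//; exact: finJ.
have dk k : (dist_p mu p S <= (kolmogorov p (dual_weight lambda (u k) p))%:E)%E.
  have := J0 k; have := JE k; rewrite -(fineK (finJ k)).
  set J := fine _ => hJ J_gt0 /=.
  pose f g := J^-1 * h k g.
  have mf : measurable_fun [set: Gamma] f by exact: measurable_funM.
  have f0 g : 0 < f g by rewrite mulr_gt0 ?invr_gt0.
  apply: le_trans (dist_p_le haar sep p1 reg mf _ _) _.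
  - exists (J^-1 * k.+1%:R^-1 `^ (- r)) => g.
    by rewrite normrM gtr0_norm ?invr_gt0// ler_wpM2l// invr_ge0 ltW.
  - under eq_integral do rewrite EFinM.
    rewrite integralZl//; last exact: ih.
    rewrite [X in (_ * X)%E](_ : _ = J%:E); last exact: esym hJ.
    by rewrite -EFinM mulVf// gt_eqF.
  rewrite (density_int muw); last 2 first.
  + by move=> g; rewrite lee_fin powR_ge0.
  + by apply/measurable_EFinP; exact: measurable_powR_abs.
  apply: (@le_trans _ _ (\int[lambda]_g ((J^-1 `^ p)%:E * (h k g)%:E))%E).
    apply: ge0_le_integral => //.
    * by move=> g _; rewrite -EFinM lee_fin mulr_ge0// powR_ge0.
    * apply: emeasurable_funM; last exact/measurable_EFinP.
      by apply/measurable_EFinP; exact: measurable_powR_abs.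
    * by apply: emeasurable_funM => //; exact/measurable_EFinP.
    * move=> g _; rewrite -!EFinM lee_fin gtr0_norm// powRM ?invr_ge0 ?(ltW J_gt0) ?(ltW (h0 k g))//.
      rewrite -mulrA; apply: ler_wpM2l; first exact: powR_ge0.
      rewrite -[leRHS](powRN_conjugateS p1 (u0 k g)).
      by apply: ler_wpM2l; [exact: powR_ge0|rewrite lerDl].
  rewrite ge0_integralZl_EFin ?powR_ge0//; last 2 first.
  + by move=> g _; rewrite lee_fin ltW.
  + exact/measurable_EFinP.
  rewrite [X in (_ * X)%E](_ : _ = J%:E); last exact: esym hJ.
  rewrite -EFinM lee_fin.
  rewrite powRD; last by apply/implyP => _; rewrite gt_eqF.
  rewrite powRr1 ?(ltW J_gt0)// mulrC powRN -[X in X <= _]mulrC.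
  by rewrite -[J^-1]powR_inv1 ?(ltW J_gt0)// -powRrM mulN1r powRN mulrC.
have cJ : kolmogorov p (dual_weight lambda (u k) p) @[k --> \oo] --> kolmogorov p W.
  by apply: cvg_kolmogorov => //; exact: cvg_dual_weightDinv.
have finD : dist_p mu p S \is a fin_num.
  by rewrite ge0_fin_numE ?dist_p_ge0//; apply: le_lt_trans (dk 0%N) (ltry _).
rewrite -(fineK finD) lee_fin -(cvg_lim (@Rhausdorff R) cJ).
apply: limr_ge; first exact: cvgP cJ.
by apply: nearW => k; rewrite -lee_fin fineK.
Qed.

End kolmogorov_formula.

(** * The lower bound for the distance *)

Lemma normc_le_Re (R : realType) (z : R[i]) :
  Normc.normc z <= complex.Re z -> z = (Normc.normc z)%:C%C.
Proof.
move=> zRe; have Rez : Normc.normc z = complex.Re z.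
  apply/eqP; rewrite eq_le zRe/=.
  by rewrite (le_trans _ (normr_Re_le z))// ler_norm.
have : complex.Re z ^+ 2 = complex.Re z ^+ 2 + complex.Im z ^+ 2.
  by rewrite -{1}Rez normcE sqr_sqrtr// addr_ge0 ?sqr_ge0.
move=> /eqP; rewrite -subr_eq0 opprD addNKr oppr_eq0 sqrf_eq0 => /eqP Im0.
by rewrite [LHS]complexE Im0 mulr0 addr0 Rez.
Qed.

Section complex_Lp.
Context {R : realType} {G : zmodType}.
Local Notation Gamma := (dual R G).
Implicit Types (mu : {finite_measure set Gamma -> \bar R}) (p : R).
Implicit Types f phi tau : Gamma -> R[i].

Lemma measurable_normc f : cmeasurable f ->
  measurable_fun [set: Gamma] (fun g => Normc.normc (f g)).
Proof.
move=> [mRe mIm]; under eq_fun do rewrite normcE.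
apply: (@measurableT_comp _ _ _ _ _ _ (@Num.sqrt R)).
  by apply: continuous_measurable_fun; exact: sqrt_continuous.
by apply: measurable_funD; exact: measurable_funX.
Qed.

Lemma cmeasurableB f1 f2 : cmeasurable f1 -> cmeasurable f2 ->
  cmeasurable (fun g => f1 g - f2 g).
Proof.
move=> [mRe1 mIm1] [mRe2 mIm2]; split.
  by under eq_fun do rewrite raddfB; exact: measurable_funB.
by under eq_fun do rewrite raddfB; exact: measurable_funB.
Qed.

Lemma cmeasurable_cst (c : R[i]) : cmeasurable (fun _ : Gamma => c).
Proof. by split; exact: measurable_cst. Qed.

Lemma measurable_int_pow p f : cmeasurable f ->
  measurable_fun [set: Gamma] (fun g => (Normc.normc (f g) `^ p)%:E).
Proof.
move=> mf; apply/measurable_EFinP.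
apply: (@measurableT_comp _ _ _ _ _ _ (fun y => y `^ p)).
  exact: measurable_powR.
exact: measurable_normc.
Qed.

Lemma int_pow_ge0 mu p f : (0 <= int_pow mu p f)%E.
Proof. by apply: integral_ge0 => g _; rewrite lee_fin powR_ge0. Qed.

Lemma int_pow_le mu p f (F : Gamma -> R) : 0 <= p -> cmeasurable f ->
  measurable_fun [set: Gamma] F -> (forall g, `|F g| <= Normc.normc (f g)) ->
  (\int[mu]_g (`|F g| `^ p)%:E <= int_pow mu p f)%E.
Proof.
move=> p0 mf mF Ff; apply: ge0_le_integral => //.
- by apply/measurable_EFinP; exact: measurable_powR_abs.
- exact: measurable_int_pow.
- by move=> g _; rewrite lee_fin ge0_ler_powR ?nnegrE ?normc_ge0.
Qed.

Lemma int_pow_cLp_norm mu p f (k : R) : 0 < p -> (cLp_norm mu p f < k%:E)%E ->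
  (int_pow mu p f <= (k `^ p)%:E)%E.
Proof.
move=> p0 fk; have pn0 : p != 0 by rewrite gt_eqF.
have -> : int_pow mu p f = (cLp_norm mu p f `^ p)%E.
  rewrite /cLp_norm (poweR_Lnorm _ _ pn0); apply: eq_integral => g _.
  by rewrite abse_EFin poweR_EFin ger0_norm ?normc_ge0.
have f0 : (0 <= cLp_norm mu p f)%E by exact: Lnorm_ge0.
rewrite -poweR_EFin; apply: gt0_ler_poweR; last exact: ltW.
- exact: ltW.
- by rewrite in_itv/= f0 leey.
- by rewrite in_itv/= leey andbT (le_trans f0)// ltW.
Qed.

End complex_Lp.

Section lower_bound.
Context {R : realType} {G : zmodType}.
Local Notation Gamma := (dual R G).
Local Notation S := [set x : G | x != 0].
Variables (lambda mu : {finite_measure set Gamma -> \bar R}) (p : R).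
Variable w : Gamma -> R.
Hypothesis haar : normalized_haar lambda.
Hypothesis sep : forall x : G, x != 0 -> exists g : Gamma, g x != 1.
Hypothesis p1 : 1 < p.
Hypothesis muw : has_density mu lambda w.
Let W := dual_weight lambda w p.
Hypothesis finW : W \is a fin_num.

Let lambda1 : lambda [set: Gamma] = 1%E. Proof. by case: haar. Qed.
Let p0 : 0 < p. Proof. exact: lt_trans p1. Qed.
Let Wr := fine W.
Let Wr_gt0 : 0 < Wr.
Proof.
apply: fine_gt0; apply/andP; split.
  by apply: dual_weight_gt0 => //; [exact: density_measurable muw|exact: density_ge0 muw].
by rewrite -ge0_fin_numE// dual_weight_ge0.
Qed.
Let WE : W = Wr%:E. Proof. by rewrite /Wr fineK. Qed.

Lemma integrable_Re f : cLp mu p f ->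
  lambda.-integrable [set: Gamma] (fun g => (complex.Re (f g))%:E).
Proof.
move=> [mf flty]; have [mRe _] := mf.
apply/integrableP; split; first exact/measurable_EFinP.
have finf : int_pow mu p f \is a fin_num.
  by rewrite ge0_fin_numE// int_pow_ge0.
pose k := (fine (int_pow mu p f) + 1) `^ p^-1.
have I0 : 0 < fine (int_pow mu p f) + 1.
  by rewrite ltr_wpDl// fine_ge0// int_pow_ge0.
have k0 : 0 < k by exact: powR_gt0.
have kp : k `^ p = fine (int_pow mu p f) + 1.
  by rewrite /k -powRrM mulVf ?gt_eqF// powRr1// ltW.
have Rek : (\int[mu]_g (`|complex.Re (f g)| `^ p)%:E <= (k `^ p)%:E)%E.
  apply: le_trans (int_pow_le mu (ltW p0) mf mRe _) _.
    by move=> g; exact: normr_Re_le.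
  by rewrite -(fineK finf) lee_fin kp lerDl.
apply: le_lt_trans (ltry _).
exact: (int_abs_small p1 muw finW mRe k0 Rek).
Qed.

(** Finiteness of W makes the mean continuous for the norm of the L^p space
    of mu, so that it still vanishes on the closure. *)
Lemma closure_mean0 phi : cLp_closure mu p (trig_poly S) phi ->
  (\int[lambda]_g (complex.Re (phi g))%:E = 0)%E.
Proof.
move=> [Lphi phiP]; have [mphi _] := Lphi; have iphi := integrable_Re Lphi.
have finI := integrable_fin_num measurableT iphi.
apply/eqP; rewrite -abse_eq0 -[X in `|X|%E](fineK finI) abse_EFin eqe normr_eq0.
rewrite -normr_le0; apply/ler_addgt0Pr => e e0; rewrite add0r.
pose C := (1 + (p - 1) * Wr) / p.
have C0 : 0 < C by rewrite divr_gt0// ltr_wpDr// mulr_ge0 ?ltW// subr_gt0.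
have k0 : 0 < e / C by rewrite divr_gt0.
have [tau ttau] := phiP _ k0; move=> /(int_pow_cLp_norm p0) phitau.
have mtau := cmeasurable_trig_poly ttau; have [mRetau _] := mtau.
have mD := cmeasurableB mphi mtau; have [mReD _] := mD.
have [M tauM] := trig_poly_bounded ttau.
have itau : lambda.-integrable [set: Gamma] (fun g => (complex.Re (tau g))%:E).
  apply: (bounded_integrable lambda mRetau (M := M)) => g.
  by rewrite (le_trans (normr_Re_le _)).
rewrite -lee_fin -abse_EFin (fineK finI).
rewrite -[X in `|X|%E](_ : (\int[lambda]_g (complex.Re (phi g - tau g))%:E)%E = _); last first.
  transitivity (\int[lambda]_g ((complex.Re (phi g))%:E - (complex.Re (tau g))%:E))%E.
    by apply: eq_integral => g _; rewrite raddfB EFinB.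
  by rewrite integralB// (haar_integral_trig_poly haar sep ttau) sube0.
apply: le_trans (le_abse_integral _ _ _) _ => //; first exact/measurable_EFinP.
rewrite -[leRHS](_ : (e / C * C)%:E = _); last by rewrite divfK// gt_eqF.
apply: (int_abs_small p1 muw finW mReD k0).
apply: le_trans phitau; apply: int_pow_le => //; first exact: ltW.
by move=> g; exact: normr_Re_le.
Qed.

Section mean_one.
Variable f : Gamma -> R[i].
Hypothesis mf : cmeasurable f.
Hypothesis if_ : lambda.-integrable [set: Gamma] (fun g => (complex.Re (f g))%:E).
Hypothesis f1 : (\int[lambda]_g (complex.Re (f g))%:E = 1)%E.

Let kp : (p - 1) * Wr^-1 `^ p * Wr = (p - 1) * Wr^-1 `^ (p - 1).
Proof.
rewrite -(mulr_powRB1 p (_ : 0 < Wr^-1)) ?invr_gt0//.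
by field; rewrite gt_eqF.
Qed.

Let Wp : Wr^-1 `^ (p - 1) = Wr `^ (1 - p).
Proof.
rewrite -[Wr^-1]powR_inv1 ?ltW// -powRrM; congr (_ `^ _); ring.
Qed.

(** The integrated tangent inequality at k = 1 / W, as the norm of f has mean at least 1. *)
Lemma int_pow_mean1_ge : ((Wr `^ (1 - p))%:E <= int_pow mu p f)%E.
Proof.
have := int_pow_ge0 mu p f.
case If : (int_pow mu p f) => [I| |] I0; [rewrite lee_fin|exact: leey|by []].
have iW : 0 < Wr^-1 by rewrite invr_gt0.
have mn := measurable_normc mf.
have normf1 : (1 <= \int[lambda]_g `|Normc.normc (f g)|%:E)%E.
  rewrite -f1; apply: le_trans (lee_abs _) _.
  apply: le_trans (le_abse_integral _ _ _) _ => //.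
    by case: mf => ? _; exact/measurable_EFinP.
  apply: ge0_le_integral => //.
  - by apply/measurable_EFinP; apply: measurableT_comp => //; case: mf.
  - by apply/measurable_EFinP; exact: measurableT_comp.
  - by move=> g _; rewrite lee_fin [leRHS]ger0_norm ?normc_ge0// normr_Re_le.
have := int_abs_le p1 muw mn iW.
rewrite -/W WE -EFinM kp (_ : (\int[mu]_x _)%E = I%:E); last first.
  by rewrite -If; apply: eq_integral => g _; rewrite ger0_norm ?normc_ge0.
have c0 : (0 <= (p * Wr^-1 `^ (p - 1))%:E)%E.
  by rewrite lee_fin mulr_ge0 ?powR_ge0// ltW.
move=> /(le_trans (lee_wpmul2l c0 normf1)).
rewrite mule1 -EFinD lee_fin -Wp; lra.
Qed.

(** Equality in the integrated tangent inequality forces equality almost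
    everywhere, where it identifies f. *)
Lemma int_pow_mean1_eq : int_pow mu p f = (Wr `^ (1 - p))%:E ->
  {ae lambda, forall g, f g = (Wr^-1 * w g `^ (- (p - 1)^-1))%:C%C}.
Proof.
move=> fE; have mw := density_measurable muw; have w0 := density_ge0 muw.
have iW : 0 < Wr^-1 by rewrite invr_gt0.
have wpos := ae_density_gt0_dual muw finW.
pose v g := w g `^ (- (p - 1)^-1).
have mv : measurable_fun [set: Gamma] v.
  apply: (@measurableT_comp _ _ _ _ _ _ (fun y => y `^ (- (p - 1)^-1))); last exact: mw.
  exact: measurable_powR.
have vW : (\int[lambda]_g (v g)%:E = Wr%:E)%E.
  rewrite -WE; apply: ae_eq_integral => //.
  - exact/measurable_EFinP.
  - exact: measurable_epowN.
  - by apply: filterS wpos => g wg _; rewrite epowN_pos.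
have v0 g : 0 <= v g by exact: powR_ge0.
have iv : lambda.-integrable [set: Gamma] (EFin \o v).
  apply/integrableP; split; first exact/measurable_EFinP.
  under eq_integral do rewrite /= ger0_norm//.
  by rewrite vW ltry.
pose A g := Normc.normc (f g) `^ p * w g.
have A0 g : 0 <= A g by rewrite mulr_ge0// powR_ge0.
have mA : measurable_fun [set: Gamma] A.
  by apply: measurable_funM => //; apply/measurable_EFinP; exact: measurable_int_pow.
have AE : (\int[lambda]_g (A g)%:E = (Wr `^ (1 - p))%:E)%E.
  rewrite -fE /int_pow (density_int muw).
  - by apply: eq_integral => g _; rewrite EFinM.
  - by move=> g; rewrite lee_fin powR_ge0.
  - exact: measurable_int_pow.
have iA : lambda.-integrable [set: Gamma] (EFin \o A).
  apply/integrableP; split; first exact/measurable_EFinP.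
  under eq_integral do rewrite /= ger0_norm//.
  by rewrite AE ltry.
pose c1 := (p - 1) * Wr^-1 `^ p; pose c2 := p * Wr^-1 `^ (p - 1).
pose D g := A g + c1 * v g - c2 * complex.Re (f g).
have mRe : measurable_fun [set: Gamma] (fun g => complex.Re (f g)) by case: mf.
have mD : measurable_fun [set: Gamma] D.
  apply: measurable_funB; last exact: measurable_funM.
  by apply: measurable_funD => //; exact: measurable_funM.
have c20 : 0 < c2 by rewrite mulr_gt0// powR_gt0.
have Dpos : {ae lambda, forall g, 0 <= D g}.
  apply: filterS wpos => g wg; rewrite subr_ge0.
  apply: le_trans (weighted_tangent p1 iW wg (normc_ge0 (f g))).
  by rewrite ler_pM2l// (le_trans (ler_norm _))// normr_Re_le.
have intD : (\int[lambda]_g (D g)%:E = 0)%E.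
  transitivity (\int[lambda]_g ((A g)%:E + c1%:E * (v g)%:E - c2%:E * (complex.Re (f g))%:E))%E.
    by apply: eq_integral => g _; rewrite -!EFinM.
  rewrite integralB//; first last.
  - exact: integrableZl.
  - by apply: integrableD => //; exact: integrableZl.
  rewrite integralD//; last exact: integrableZl.
  rewrite integralZl// integralZl// AE vW f1 mule1 -!EFinM -EFinD.
  by rewrite /c1 kp /c2 -Wp; congr EFin; ring.
have : ae_eq lambda [set: Gamma] (EFin \o D) (cst 0%E).
  apply: (@ae_eq_integral_abs _ _ _ lambda _ measurableT _ _).1.
    exact/measurable_EFinP.
  rewrite -[RHS]intD; apply: ae_eq_integral => //.
  - by apply/measurable_EFinP; exact: measurableT_comp.
  - exact/measurable_EFinP.
  - by apply: filterS Dpos => g Dg _; rewrite /= ger0_norm.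
apply: filterS2 wpos => g wg /(_ I) /= [/eqP]; rewrite subr_eq0 => /eqP Dg.
have tan := weighted_tangent p1 iW wg (normc_ge0 (f g)).
have ReN : Normc.normc (f g) <= complex.Re (f g).
  by rewrite -(ler_pM2l c20); move: tan; rewrite -/c2 -/c1 -Dg.
rewrite [LHS](normc_le_Re ReN); congr (_ %:C%C).
apply/eqP/negPn/negP => neq.
have := weighted_tangent_lt p1 iW wg (normc_ge0 (f g)) neq.
rewrite -/c2 -/c1 -/(v g) -/(A g) Dg ltr_pM2l// ltNge.
by rewrite (le_trans (ler_norm _))// normr_Re_le.
Qed.

End mean_one.

End lower_bound.

(** * Kolmogorov's formula and the metric projection *)

Section distance_formula.
Context {R : realType} {G : zmodType}.
Local Notation Gamma := (dual R G).
Local Notation S := [set x : G | x != 0].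
Variables (lambda mu : {finite_measure set Gamma -> \bar R}) (p : R).
Variable w : Gamma -> R.
Hypothesis haar : normalized_haar lambda.
Hypothesis sep : forall x : G, x != 0 -> exists g : Gamma, g x != 1.
Hypothesis p1 : 1 < p.
Hypothesis reg : regular_measure mu.
Hypothesis muw : has_density mu lambda w.
Let W := dual_weight lambda w p.
Let lambda1 : lambda [set: Gamma] = 1%E. Proof. by case: haar. Qed.

Let mean_one (phi : Gamma -> R[i]) :
  lambda.-integrable [set: Gamma] (fun g => (complex.Re (phi g))%:E) ->
  (\int[lambda]_g (complex.Re (phi g))%:E = 0)%E ->
  lambda.-integrable [set: Gamma] (fun g => (complex.Re (1 - phi g)%R)%:E) /\
  (\int[lambda]_g (complex.Re (1 - phi g)%R)%:E = 1)%E.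
Proof.
move=> iphi phi0.
have i1 : lambda.-integrable [set: Gamma] (cst 1%:E).
  exact: finite_measure_integrable_cst.
have E : (fun g => (complex.Re (1 - phi g)%R)%:E) =
    (fun g => 1%:E - (complex.Re (phi g))%:E)%E.
  by apply/funext => g; rewrite raddfB EFinB.
rewrite E; split; first exact: integrableB.
by rewrite integralB// phi0 sube0 integral_cst// mul1e.
Qed.

Theorem dist_pE : dist_p mu p S = (kolmogorov p W)%:E.
Proof.
have leW := dist_p_le_kolmogorov haar sep p1 reg muw.
have ge0 := dist_p_ge0 (G := G) mu p.
apply/eqP; rewrite eq_le leW/=.
have W0 : (0 <= W)%E by exact: dual_weight_ge0.
have [finW|] := boolP (W \is a fin_num); last first.
  by rewrite ge0_fin_numE// -leNgt leye_eq => /eqP ->.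
rewrite -(fineK finW) /=.
apply: le_ereal_inf_tmp => _ [tau ttau <-].
have mtau := cmeasurable_trig_poly ttau; have [M tauM] := trig_poly_bounded ttau.
have itau : lambda.-integrable [set: Gamma] (fun g => (complex.Re (tau g))%:E).
  have [mRe _] := mtau; apply: (bounded_integrable lambda mRe (M := M)) => g.
  by rewrite (le_trans (normr_Re_le _)).
have [i1 int1] := mean_one itau (haar_integral_trig_poly haar sep ttau).
apply: (int_pow_mean1_ge haar p1 muw finW _ int1).
exact: cmeasurableB (cmeasurable_cst _) mtau.
Qed.

Lemma metric_projectionE (phi : Gamma -> R[i]) : W \is a fin_num ->
  is_metric_projection mu p S phi ->
  {ae lambda, forall g, 1 - phi g = ((fine W)^-1 * w g `^ (- (p - 1)^-1))%:C%C}.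
Proof.
move=> finW [clphi phid]; have [Lphi _] := clphi; have [mphi _] := Lphi.
have [i1 int1] := mean_one (integrable_Re p1 muw finW Lphi)
  (closure_mean0 haar sep p1 muw finW clphi).
apply: (int_pow_mean1_eq haar p1 muw finW _ i1 int1).
  exact: cmeasurableB (cmeasurable_cst _) mphi.
by rewrite phid dist_pE -[in LHS](fineK finW).
Qed.

End distance_formula.

(** * Passage to the limit *)

Section dual_weight_cvg.
Context d (T : measurableType d) (R : realType).
Variables (la : {finite_measure set T -> \bar R}) (p : R).
Hypothesis p1 : 1 < p.
Let r : R := (p - 1)^-1.
Let r0 : 0 < r. Proof. by rewrite invr_gt0 subr_gt0. Qed.

Lemma cvg_dual_weight_dominated (u : nat -> T -> R) (u0 : T -> R) (F : T -> \bar R) :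
  (forall n, measurable_fun [set: T] (u n)) -> measurable_fun [set: T] u0 ->
  (forall n x, 0 <= u n x) ->
  {ae la, forall x, u n x @[n --> \oo] --> u0 x} ->
  la.-integrable [set: T] F ->
  {ae la, forall x n, (epowN r (u n x) <= F x)%E} ->
  dual_weight la (u n) p @[n --> \oo] --> dual_weight la u0 p.
Proof.
move=> mu_ mu0 u_ge0 cvu iF uF; rewrite /dual_weight -/r.
have [] := @dominated_convergence _ T R la [set: T] measurableT
  (fun n x => epowN r (u n x)) (fun x => epowN r (u0 x)) F => //.
- by move=> n; exact: measurable_epowN.
- exact: measurable_epowN.
- by apply: filterS cvu => x cvx _; exact: cvg_epowN.
- by apply: filterS uF => x uFx n _; rewrite gee0_abs ?epowN_ge0.
Qed.

(** The functions of the n-th integral are dominated by a multiple of the limit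
    function, which is integrable when the limit is finite. *)
Lemma cvg_dual_weight (w : nat -> T -> R) (w0 : T -> R) (c : R) : 0 < c ->
  (forall n, measurable_fun [set: T] (w n)) -> measurable_fun [set: T] w0 ->
  (forall n x, 0 <= w n x) -> (forall x, 0 <= w0 x) ->
  {ae la, forall x, w n x @[n --> \oo] --> w0 x} ->
  {ae la, forall x n, c * w0 x <= w n x} ->
  dual_weight la (w n) p @[n --> \oo] --> dual_weight la w0 p.
Proof.
move=> c0 mw mw0 w_ge0 w0_ge0 cvw cw.
have W0 : (0 <= dual_weight la w0 p)%E by exact: dual_weight_ge0.
have [finW|] := boolP (dual_weight la w0 p \is a fin_num).
  apply: (@cvg_dual_weight_dominated _ _ (fun x => (c `^ (- r))%:E * epowN r (w0 x))%E) => //.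
    apply: integrableZl => //; apply/integrableP; split; first exact: measurable_epowN.
    under eq_integral do rewrite gee0_abs ?epowN_ge0//.
    by rewrite -ge0_fin_numE.
  apply: filterS cw => x cwx n; rewrite -epowNM//.
  by apply: epowN_le (cwx n); [exact: ltW|rewrite mulr_ge0// ltW].
rewrite ge0_fin_numE// -leNgt leye_eq => /eqP Woo; rewrite Woo.
(* the truncations w n + 1 / (k + 1) converge boundedly as n grows *)
have cvk := @cvg_dual_weightDinv _ _ _ la _ p1 _ mw0 w0_ge0.
rewrite Woo in cvk; apply/cvgeyPge => A.
have /cvgeyPgt/(_ A)[k _ /(_ k (leqnn k)) /= Ak] := cvk.
have k0 : 0 < k.+1%:R^-1 :> R by rewrite invr_gt0.
have uk0 (v : T -> R) x : (forall x, 0 <= v x) -> 0 < v x + k.+1%:R^-1.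
  by move=> v0; rewrite ltr_wpDl.
have : dual_weight la (fun x => w n x + k.+1%:R^-1) p @[n --> \oo] -->
    dual_weight la (fun x => w0 x + k.+1%:R^-1) p.
  apply: (@cvg_dual_weight_dominated _ _ (cst (epowN r k.+1%:R^-1))).
  - by move=> n; exact: measurable_funD.
  - exact: measurable_funD.
  - by move=> n x; apply/ltW/uk0.
  - by apply: filterS cvw => x cvx; apply: cvgD => //; exact: cvg_cst.
  - by rewrite epowN_pos//; exact: finite_measure_integrable_cst.
  - by apply: aeW => x n; apply: epowN_le; rewrite ?lerDr// ltW.
move=> cvn.
have : \forall n \near \oo, (A%:E < dual_weight la (fun x => (w n x + k.+1%:R^-1)%R) p)%E.
  by apply: (cvn [set y | (A%:E < y)%E]); apply: open_nbhs_nbhs; split => //; exact: open_ereal_gt_ereal.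
apply: filterS => n /ltW /le_trans; apply.
apply: ge0_le_integral => //.
- by move=> x _; exact: epowN_ge0.
- by apply: measurable_epowN; exact: measurable_funD.
- exact: measurable_epowN.
- by move=> x _; apply: epowN_le; rewrite ?lerDl// ltW.
Qed.

End dual_weight_cvg.

Section projection_at_distance_zero.
Context {R : realType} {G : zmodType}.
Local Notation Gamma := (dual R G).
Implicit Types (mu lambda : {finite_measure set Gamma -> \bar R}).
Variable p : R.
Hypothesis p1 : 1 < p.
Let p0 : 0 < p. Proof. exact: lt_trans p1. Qed.

Lemma int_pow_sub_le mu (f1 f2 : Gamma -> R[i]) : cmeasurable f1 -> cmeasurable f2 ->
  (int_pow mu p (fun g => f1 g - f2 g)%R <= (2^-1 `^ (1 - p))%:E *
    (int_pow mu p (fun g => 1 - f1 g)%R + int_pow mu p (fun g => 1 - f2 g)%R))%E.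
Proof.
move=> m1 m2.
have mB f : cmeasurable f -> cmeasurable (fun g : Gamma => 1 - f g).
  exact: cmeasurableB (cmeasurable_cst _).
have mi1 := measurable_int_pow p (mB _ m1); have mi2 := measurable_int_pow p (mB _ m2).
have i0 (f : Gamma -> R[i]) g : [set: Gamma] g -> (0 <= (Normc.normc (f g) `^ p)%:E)%E.
  by move=> _; rewrite lee_fin powR_ge0.
rewrite /int_pow -ge0_integralD//; try exact: (i0 (fun g => 1 - _)).
rewrite -ge0_integralZl_EFin ?powR_ge0//; first last.
- exact: emeasurable_funD.
- by move=> g _; rewrite adde_ge0// lee_fin powR_ge0.
apply: ge0_le_integral => //.
- by move=> g _; rewrite lee_fin powR_ge0.
- exact: measurable_int_pow (cmeasurableB m1 m2).
- by apply: emeasurable_funM => //; exact: emeasurable_funD.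
move=> g _; rewrite -EFinD -EFinM lee_fin.
have half : 0 < (2^-1 : R) < 1 by apply/andP; split; lra.
have := powRD_le (ltW p1) half (normc_ge0 (1 - f1 g)) (normc_ge0 (1 - f2 g)).
rewrite [X in X `^ (1 - p) * _ + _](_ : 1 - 2^-1 = 2^-1 :> R); last by lra.
rewrite -mulrDr; apply: le_trans.
apply: ge0_ler_powR; rewrite ?nnegrE ?addr_ge0 ?normc_ge0//; first exact: ltW.
have -> : f1 g - f2 g = (1 - f2 g) + (f1 g - 1) by ring.
by rewrite [X in _ <= X + _]normc_distC [leRHS]addrC ler_normcD.
Qed.

Lemma int_pow_density_le mu0 mu1 lambda (w0 w1 : Gamma -> R) (c : R) f :
  has_density mu0 lambda w0 -> has_density mu1 lambda w1 -> 0 < c ->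
  {ae lambda, forall g, c * w0 g <= w1 g} -> cmeasurable f ->
  (int_pow mu0 p f <= c^-1%:E * int_pow mu1 p f)%E.
Proof.
move=> d0 d1 c0 cw mf; have mi := measurable_int_pow p mf.
have i0 g : (0 <= (Normc.normc (f g) `^ p)%:E)%E by rewrite lee_fin powR_ge0.
rewrite /int_pow (density_int d0)// (density_int d1)//.
have mw0 := density_measurable d0; have mw1 := density_measurable d1.
have mi1 : measurable_fun [set: Gamma] (fun g => (Normc.normc (f g) `^ p)%:E * (w1 g)%:E)%E.
  by apply: emeasurable_funM => //; exact/measurable_EFinP.
have mi0 : measurable_fun [set: Gamma] (fun g => (Normc.normc (f g) `^ p)%:E * (w0 g)%:E)%E.
  by apply: emeasurable_funM => //; exact/measurable_EFinP.
have ic0 : 0 <= c^-1 by rewrite invr_ge0 ltW.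
have pos0 g : (0 <= (Normc.normc (f g) `^ p)%:E * (w0 g)%:E)%E.
  by rewrite mule_ge0// lee_fin (density_ge0 d0).
have pos1 g : (0 <= (Normc.normc (f g) `^ p)%:E * (w1 g)%:E)%E.
  by rewrite mule_ge0// lee_fin (density_ge0 d1).
rewrite -ge0_integralZl_EFin//; apply: ae_ge0_le_integral => //.
- by move=> g _; rewrite mule_ge0// lee_fin.
- exact: emeasurable_funM.
- apply: filterS cw => g cwg _; rewrite -!EFinM lee_fin mulrCA.
  by rewrite ler_wpM2l ?powR_ge0// mulrC ler_pdivlMr// mulrC.
Qed.

Variables (lambda mu0 : {finite_measure set Gamma -> \bar R}).
Variables (mu : nat -> {finite_measure set Gamma -> \bar R}).
Variables (w0 : Gamma -> R) (w : nat -> Gamma -> R) (c : R) (S : set G).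
Hypothesis mu0w : has_density mu0 lambda w0.
Hypothesis muw : forall n, has_density (mu n) lambda (w n).
Hypothesis c0 : 0 < c.
Hypothesis cw : forall n, {ae lambda, forall g, c * w0 g <= w n g}.

(** Both projections are close to 1 in L^p(mu0): the first one because the distance is zero,
    the others because mu0 is dominated by mu n / c. *)
Lemma cvg_projection_dist0 (phi0 : Gamma -> R[i]) (phi : nat -> Gamma -> R[i]) :
  dist_p mu0 p S = 0%E -> dist_p (mu n) p S @[n --> \oo] --> 0%E ->
  is_metric_projection mu0 p S phi0 ->
  (forall n, is_metric_projection (mu n) p S (phi n)) ->
  int_pow mu0 p (fun g => phi0 g - phi n g) @[n --> \oo] --> 0%E.
Proof.
move=> d0 dn [[[m0 _] _] i0] phiP.
have m n : cmeasurable (phi n) by have [[[]]] := phiP n.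
have le n : (int_pow mu0 p (fun g => phi0 g - phi n g)%R <=
    (2^-1 `^ (1 - p) * c^-1)%:E * dist_p (mu n) p S)%E.
  apply: le_trans (int_pow_sub_le mu0 m0 (m n)) _.
  rewrite i0 d0 add0e EFinM -muleA; apply: lee_wpmul2l; first by rewrite lee_fin powR_ge0.
  have [_ <-] := phiP n.
  apply: (int_pow_density_le mu0w (muw n) c0 (cw n)).
  exact: cmeasurableB (cmeasurable_cst _) (m n).
apply: (@squeeze_cvge _ _ _ _ (cst 0%E) _
  (fun n => (2^-1 `^ (1 - p) * c^-1)%:E * dist_p (mu n) p S)%E).
- by apply: nearW => n; rewrite int_pow_ge0 le.
- exact: cvg_cst.
- rewrite -[X in _ --> X](mule0 (2^-1 `^ (1 - p) * c^-1)%:E).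
  exact: cvgeZl.
Qed.

End projection_at_distance_zero.

Section convergence.
Context {R : realType} {G : zmodType}.
Local Notation Gamma := (dual R G).
Local Notation S := [set x : G | x != 0].
Variables (lambda mu0 : {finite_measure set Gamma -> \bar R}).
Variables (mu : nat -> {finite_measure set Gamma -> \bar R}).
Variables (w0 : Gamma -> R) (w : nat -> Gamma -> R) (c p : R).
Hypothesis haar : normalized_haar lambda.
Hypothesis sep : forall x : G, x != 0 -> exists g : Gamma, g x != 1.
Hypothesis p1 : 1 < p.
Hypothesis reg0 : regular_measure mu0.
Hypothesis reg : forall n, regular_measure (mu n).
Hypothesis mu0w : has_density mu0 lambda w0.
Hypothesis muw : forall n, has_density (mu n) lambda (w n).
Hypothesis c0 : 0 < c.
Hypothesis cw : forall n, {ae lambda, forall g, c * w0 g <= w n g}.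
Hypothesis cvw : {ae lambda, forall g, w n g @[n --> \oo] --> w0 g}.

Let W0 := dual_weight lambda w0 p.
Let W n := dual_weight lambda (w n) p.
Let lambda1 : lambda [set: Gamma] = 1%E. Proof. by case: haar. Qed.
Let r : R := (p - 1)^-1.
Let r0 : 0 < r. Proof. by rewrite invr_gt0 subr_gt0. Qed.
Let p0 : 0 < p. Proof. exact: lt_trans p1. Qed.

Let W0_gt0 : (0 < W0)%E.
Proof.
apply: dual_weight_gt0 => //; first exact: density_measurable mu0w.
exact: density_ge0 mu0w.
Qed.

Let cvW : W n @[n --> \oo] --> W0.
Proof.
apply: (cvg_dual_weight p1 c0) => //.
- by move=> n; exact: density_measurable (muw n).
- exact: density_measurable mu0w.
- by move=> n; exact: density_ge0 (muw n).
- exact: density_ge0 mu0w.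
- exact: ae_foralln cw.
Qed.

Lemma cvg_dist_p : dist_p (mu n) p S @[n --> \oo] --> dist_p mu0 p S.
Proof.
rewrite (dist_pE haar sep p1 reg0 mu0w).
under eq_fun do rewrite (dist_pE haar sep p1 (reg _) (muw _)).
by apply/cvg_EFin; [exact: nearW|exact: cvg_kolmogorov].
Qed.

(** When W0 is finite, 1 - phi n is the normalized power of w n, and
    the domination by w0 `^ (- (p - 1)^-1) allows to pass to the limit. *)
Lemma cvg_projection (phi0 : Gamma -> R[i]) (phi : nat -> Gamma -> R[i]) :
  is_metric_projection mu0 p S phi0 ->
  (forall n, is_metric_projection (mu n) p S (phi n)) ->
  int_pow mu0 p (fun g => phi0 g - phi n g) @[n --> \oo] --> 0%E.
Proof.
move=> phi0P phiP.
have [finW0|] := boolP (W0 \is a fin_num); last first.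
  rewrite ge0_fin_numE ?dual_weight_ge0// -leNgt leye_eq => /eqP W0oo.
  have d0 : dist_p mu0 p S = 0%E.
    by rewrite (dist_pE haar sep p1 reg0 mu0w) -/W0 W0oo.
  apply: (cvg_projection_dist0 p1 mu0w muw c0 cw d0 _ phi0P phiP).
  by rewrite -[X in _ --> X]d0; exact: cvg_dist_p.
have mw0 := density_measurable mu0w; have w0_ge0 := density_ge0 mu0w.
have m0 : cmeasurable phi0 by have [[[]]] := phi0P.
have m n : cmeasurable (phi n) by have [[[]]] := phiP n.
have w0pos := ae_density_gt0_dual mu0w finW0.
have finW n : W n \is a fin_num.
  rewrite ge0_fin_numE ?dual_weight_ge0//.
  apply: (@le_lt_trans _ _ ((c `^ (- r))%:E * W0)%E); last first.
    by rewrite -(fineK finW0) -EFinM ltry.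
  rewrite -ge0_integralZl_EFin ?powR_ge0//; first last.
  - exact: measurable_epowN.
  - by move=> g _; exact: epowN_ge0.
  apply: ae_ge0_le_integral => //.
  - by move=> g _; exact: epowN_ge0.
  - by apply: measurable_epowN; exact: density_measurable (muw n).
  - by move=> g _; rewrite mule_ge0 ?epowN_ge0// lee_fin powR_ge0.
  - by apply: emeasurable_funM => //; exact: measurable_epowN.
  - apply: filterS (cw n) => g cwg _; rewrite -epowNM//.
    by apply: epowN_le cwg; [exact: ltW|rewrite mulr_ge0// ltW].
have aeE0 := metric_projectionE haar sep p1 reg0 mu0w finW0 phi0P.
have aeE n := metric_projectionE haar sep p1 (reg n) (muw n) (finW n) (phiP n).
have Wr0 : 0 < fine W0.
  by apply: fine_gt0; rewrite W0_gt0 -ge0_fin_numE// dual_weight_ge0.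
have cvWr : fine (W n) @[n --> \oo] --> fine W0.
  by have := cvW; rewrite -{1}(fineK finW0) => /fine_cvgP[].
have cvWi : (fine (W n))^-1 @[n --> \oo] --> (fine W0)^-1.
  by apply: cvgV => //; rewrite gt_eqF.
have [B B0 WB] : exists2 B : R, 0 < B & forall n, (fine (W n))^-1 <= B.
  have [M [_ MB]] := cvg_seq_bounded (cvgP _ cvWi).
  exists (`|M| + 1); first by rewrite ltr_wpDl.
  move=> n; apply: le_trans (ler_norm _) _; apply: MB => //.
  by rewrite (le_lt_trans (ler_norm _))// ltrDl.
pose v0 g := w0 g `^ (- r); pose v n g := w n g `^ (- r).
pose C := B * c `^ (- r) + (fine W0)^-1.
have C0 : 0 <= C.
  by rewrite addr_ge0 ?invr_ge0 ?(ltW Wr0)// mulr_ge0 ?powR_ge0// ltW.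
have mv0 : measurable_fun [set: Gamma] v0.
  apply: (@measurableT_comp _ _ _ _ _ _ (fun y => y `^ (- r))); last exact: mw0.
  exact: measurable_powR.
pose F n g := Normc.normc (phi0 g - phi n g) `^ p * w0 g.
have FE n : int_pow mu0 p (fun g => phi0 g - phi n g)%R = (\int[lambda]_g (F n g)%:E)%E.
  rewrite /int_pow (density_int mu0w).
  - by apply: eq_integral => g _; rewrite EFinM.
  - by move=> g; rewrite lee_fin powR_ge0.
  - exact: measurable_int_pow (cmeasurableB m0 (m n)).
have aeF : {ae lambda, forall g, [/\ 0 < w0 g, (forall n, c * w0 g <= w n g),
    w n g @[n --> \oo] --> w0 g & forall n,
    F n g = `|(fine (W n))^-1 * v n g - (fine W0)^-1 * v0 g| `^ p * w0 g]}.
  have h1 := ae_and w0pos (ae_and (ae_foralln cw) cvw).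
  have h2 := ae_and aeE0 (ae_foralln aeE).
  apply: filterS2 h1 h2 => g [w0g [cwg cvg_]] [e0 en]; split => // n.
  rewrite /F; congr (_ `^ p * _).
  rewrite -[X in Normc.normc X](_ : (1 - phi n g) - (1 - phi0 g) = _); last by ring.
  by rewrite e0 en -rmorphB normc_real.
under eq_fun do rewrite FE.
have [] := @dominated_convergence _ Gamma R lambda [set: Gamma] measurableT
  (fun n g => (F n g)%:E) (cst 0%E) (fun g => (C `^ p * v0 g)%:E).
- move=> n; apply/measurable_EFinP/measurable_funM => //.
  by apply/measurable_EFinP; exact: measurable_int_pow (cmeasurableB m0 (m n)).
- exact: measurable_cst.
- apply: filterS aeF => g [w0g cwg cvg_ Fg] _.
  apply/cvg_EFin; first exact: nearW.
  suff : F n g @[n --> \oo] --> (0 : R) by [].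
  under eq_fun do rewrite Fg.
  have cd : (fine (W n))^-1 * v n g - (fine W0)^-1 * v0 g @[n --> \oo] --> (0 : R).
    rewrite -[X in _ --> X](subrr ((fine W0)^-1 * v0 g)).
    apply: cvgB; last exact: cvg_cst.
    by apply: cvgM => //; exact: cvg_powR.
  have cdp : `|(fine (W n))^-1 * v n g - (fine W0)^-1 * v0 g| `^ p @[n --> \oo] -->
      (0 : R).
    by apply: cvg_powR0 => //; rewrite -[X in _ --> X](normr0 R); exact: cvg_norm.
  have cprod : `|(fine (W n))^-1 * v n g - (fine W0)^-1 * v0 g| `^ p * w0 g
      @[n --> \oo] --> 0 * w0 g.
    by apply: cvgM; [exact: cdp|exact: cvg_cst].
  by rewrite mul0r in cprod.
- apply/integrableP; split; first by apply/measurable_EFinP; exact: measurable_funM.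
  under eq_integral do rewrite /= ger0_norm ?mulr_ge0 ?powR_ge0// EFinM.
  rewrite ge0_integralZl_EFin ?powR_ge0//; first last.
  + exact/measurable_EFinP.
  + by move=> g _; rewrite lee_fin powR_ge0.
  rewrite (_ : (\int[lambda]_g (v0 g)%:E)%E = W0).
    by rewrite -(fineK finW0) -EFinM ltry.
  apply: ae_eq_integral => //.
  + exact/measurable_EFinP.
  + exact: measurable_epowN.
  + by apply: filterS w0pos => g w0g _; rewrite epowN_pos.
- apply: filterS aeF => g [w0g cwg cvg_ Fg] n _.
  rewrite lee_fin Fg ger0_norm ?mulr_ge0 ?powR_ge0//.
  have v0E : v0 g = v0 g `^ p * w0 g by exact/esym/powRN_conjugateS.
  rewrite [X in _ <= _ * X]v0E mulrA ler_wpM2r// -powRM ?powR_ge0//.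
  apply: ge0_ler_powR; rewrite ?nnegrE ?mulr_ge0 ?powR_ge0 ?(ltW p0)//.
  have vn : v n g <= c `^ (- r) * v0 g.
    rewrite /v0 -powRM ?(ltW c0)//; apply: ler_powRN; [exact: ltW|exact: mulr_gt0|exact: cwg].
  have Wi n' : 0 <= (fine (W n'))^-1 by rewrite invr_ge0; apply: fine_ge0; exact: dual_weight_ge0.
  rewrite (le_trans (ler_normB _ _))// /C mulrDl lerD//.
    rewrite ger0_norm ?mulr_ge0 ?powR_ge0// -mulrA.
    apply: ler_pM => //; exact: powR_ge0.
  by rewrite ger0_norm// mulr_ge0 ?powR_ge0// invr_ge0 ltW.
by move=> _ _; rewrite integral0.
Qed.

End convergence.

(** A nontrivial character constantly equal to 1 lies in the space of the
    competitors, at distance zero from the function 1. *)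
Lemma dist_p_trivial_character (R : realType) (G : zmodType) (x : G) :
  x != 0 -> (forall g : dual R G, g x = 1) ->
  forall (mu : {finite_measure set (dual R G) -> \bar R}) (p : R), 1 < p ->
  dist_p mu p [set x | x != 0] = 0%E.
Proof.
move=> x0 x1 mu p p1; apply/eqP; rewrite eq_le dist_p_ge0 andbT.
have <- : int_pow mu p (fun g : dual R G => 1 - 1 * g x) = 0%E.
  apply: integral0_eq => g _; rewrite x1 mul1r normc_distrr powR0//.
  by rewrite gt_eqF// (lt_trans _ p1).
apply: ereal_inf_lbound; exists (fun g : dual R G => 1 * g x); last by [].
exact: trig_poly_mono.
Qed.

Theorem corollary4p10 (R : realType) (G : zmodType)
  (G_neq0 : exists x : G, x != 0)
  (lambda : {finite_measure set (dual R G) -> \bar R})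
  (lambda_haar : normalized_haar lambda)
  (p : R) (p_gt1 : 1 < p)
  (mu0 : {finite_measure set (dual R G) -> \bar R})
  (mu : nat -> {finite_measure set (dual R G) -> \bar R})
  (mu0_M : classM mu0) (mu_M : forall n, classM (mu n))
  (mu0_ac : mu0 `<< lambda) (mu_ac : forall n, mu n `<< lambda)
  (mu_cvg : mlim mu mu0)
  (c : R) (c_gt0 : 0 < c)
  (mu_ge : forall n (A : set (dual R G)), measurable A ->
     (c%:E * mu0 A <= mu n A)%E) :
  let S : set G := [set x | x != 0] in
  (dist_p (mu n) p S @[n --> \oo] --> dist_p mu0 p S) /\
  ((forall n, mu0 `<< mu n) ->
   forall (phi0 : dual R G -> R[i]) (phi : nat -> dual R G -> R[i]),
     is_metric_projection mu0 p S phi0 ->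
     (forall n, is_metric_projection (mu n) p S (phi n)) ->
     int_pow mu0 p (fun g => phi0 g - phi n g) @[n --> \oo] --> 0%E).
Proof.
move=> S.
have dens0 := RN_densityP mu0_ac; have dens n := RN_densityP (mu_ac n).
have reg0 : regular_measure mu0 by case: mu0_M.
have reg n : regular_measure (mu n) by case: (mu_M n).
have cw n := ae_density_le (ltW c_gt0) dens0 (dens n) (mu_ge n).
have [sep|/existsNP[x /not_implyP[x0 /forallNP x1]]] :=
    pselect (forall x : G, x != 0 -> exists g : dual R G, g x != 1); last first.
  have d0 nu : dist_p nu p S = 0%E.
    apply: (dist_p_trivial_character x0) p_gt1 => g.
    by apply/eqP/negPn/negP; exact: x1.
  split; first by rewrite d0; under eq_fun do rewrite d0; exact: cvg_cst.
  move=> _ phi0 phi; apply: (cvg_projection_dist0 p_gt1 dens0 dens c_gt0 cw (d0 mu0)).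
  by under eq_fun do rewrite d0; exact: cvg_cst.
have [nu [_ mu0nu munu cvnu]] := mu_cvg.
have sub (f : nat -> nat) : f n @[n --> \oo] --> \oo ->
    exists2 g : nat -> nat, g n @[n --> \oo] --> \oo &
    {ae lambda, forall x, RN_density (mu (f (g n))) lambda x @[n --> \oo] -->
                          RN_density mu0 lambda x}.
  move=> foo; apply: (@cvg_in_measure_density_ae _ _ _ nu lambda (mu \o f)) => //.
  - by move=> n; exact: munu.
  - by move=> n; exact: mu_ac.
  - by move=> e e0; exact: cvg_comp foo (cvnu e e0).
split.
  apply: cvg_subseqs => f /sub[g goo cvg_]; exists g => //.
  exact: (cvg_dist_p lambda_haar sep p_gt1 reg0 (fun n => reg (f (g n))) dens0
    (fun n => dens (f (g n))) c_gt0 (fun n => cw (f (g n))) cvg_).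
move=> _ phi0 phi phi0P phiP.
apply: cvg_subseqs => f /sub[g goo cvg_]; exists g => //.
exact: (cvg_projection lambda_haar sep p_gt1 reg0 (fun n => reg (f (g n))) dens0
  (fun n => dens (f (g n))) c_gt0 (fun n => cw (f (g n))) cvg_ phi0P
  (fun n => phiP (f (g n)))).
Qed.
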